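(* Let $\mathbb{T}$ be a time scale that is unbounded above and has bounded graininess, let $t_0<t_f$ be points of $\mathbb{T}$, and let $A(t)\in\mathbb{R}^{n\times n}$, $B(t)\in\mathbb{R}^{n\times m}$, $C(t)\in\mathbb{R}^{p\times n}$, $D(t)\in\mathbb{R}^{p\times m}$ be rd-continuous matrix functions on $\mathbb{T}$ with $p,m\le n$ and $A$ regressive. The regressive linear system $$x^{\Delta}(t)=A(t)x(t)+B(t)u(t),\quad x(t_0)=x_0,\qquad y(t)=C(t)x(t)+D(t)u(t),$$ is controllable on $[t_0,t_f]$ if and only if the $n\times n$ controllability Gramian matrix $$\mathscr{G}_{C}(t_0,t_f):=\int_{t_0}^{t_f}\Phi_{A}(t_0,\sigma(t))B(t)B^{T}(t)\Phi^{T}_{A}(t_0,\sigma(t))\,\Delta t$$ is invertible.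
   Context: A time scale $\mathbb{T}$ is a nonempty closed subset of $\mathbb{R}$, with forward jump operator $\sigma(t)=\inf\{s\in\mathbb{T}:s>t\}$ and graininess $\mu(t)=\sigma(t)-t$; $f^\Delta$ denotes the delta derivative and $\int f(t)\,\Delta t$ the delta integral. Intervals are understood to be intersected with $\mathbb{T}$. A function is rd-continuous if it is continuous at right-dense points of $\mathbb{T}$ and has finite left limits at left-dense points. The matrix function $A$ (or the system) is regressive if $I+\mu(t)A(t)$ is invertible for all $t\in\mathbb{T}$. $\Phi_A(t,s)$ is the transition matrix: the unique solution $X(t)$ of $X^\Delta(t)=A(t)X(t)$, $X(s)=I$. The system is controllable on $[t_0,t_f]$ if for every initial state $x_0\in\mathbb{R}^n$ and every prescribed final state $x_f\in\mathbb{R}^n$ there exists an rd-continuous input $u(t)$ such that the corresponding solution satisfies $x(t_f)=x_f$. *)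

(* Defs.v *)
From HB Require Import structures.
From mathcomp Require Import all_boot all_order all_algebra.
From mathcomp Require Import all_classical all_reals all_analysis.

Set Implicit Arguments.
Unset Strict Implicit.
Unset Printing Implicit Defensive.

Import Order.TTheory GRing.Theory Num.Theory.
Import numFieldNormedType.Exports.

Local Open Scope classical_set_scope.
Local Open Scope ring_scope.

(* Functions on a time scale T are total functions on R whose values outside
   T are never inspected. *)

Definition time_scale (R : realType) (T : set R) : Prop :=
  T !=set0 /\ closed T.

Definition unbounded_above (R : realType) (T : set R) : Prop :=
  ~ has_ubound T.

(* [inf set0 = 0] in the library: at a maximum of T this is a junk value, which
   does not occur when T is unbounded above. *)
Definition forward_jump (R : realType) (T : set R) (t : R) : R :=
  inf [set s | T s /\ t < s].

Definition backward_jump (R : realType) (T : set R) (t : R) : R :=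
  sup [set s | T s /\ s < t].

Definition graininess (R : realType) (T : set R) (t : R) : R :=
  forward_jump T t - t.

Definition bounded_graininess (R : realType) (T : set R) : Prop :=
  exists M : R, forall t, T t -> graininess T t <= M.

(* A maximum (resp. minimum) of T is neither right-dense (resp. left-dense). *)
Definition right_dense (R : realType) (T : set R) (t : R) : Prop :=
  (exists2 s, T s & t < s) /\ forward_jump T t = t.

Definition left_dense (R : realType) (T : set R) (t : R) : Prop :=
  (exists2 s, T s & s < t) /\ backward_jump T t = t.

Definition rd_continuous (R : realType) (T : set R) (f : R -> R) : Prop :=
  (forall t, T t -> right_dense T t -> f s @[s --> within T (nbhs t)] --> f t) /\
  (forall t, T t -> left_dense T t ->
     exists l : R, f s @[s --> within T (t^'-)] --> l).

(* Hilger's definition of "f is delta differentiable at t and f^Delta(t) = d". *)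
Definition is_delta_derive (R : realType) (T : set R) (f : R -> R) (t d : R)
    : Prop :=
  forall e : R, 0 < e -> \forall s \near within T (nbhs t),
    `|f (forward_jump T t) - f s - d * (forward_jump T t - s)|
      <= e * `|forward_jump T t - s|.

(* The points of differentiation range over T rather than T^kappa: the two
   coincide when T is unbounded above. *)
Definition delta_antiderivative (R : realType) (T : set R) (F f : R -> R)
    : Prop :=
  forall t, T t -> is_delta_derive T F t (f t).

(* Cauchy delta integral: F(b) - F(a) for an antiderivative F of f. For a, b in
   T this value is independent of F, and F exists when f is rd-continuous. *)
Definition delta_integral (R : realType) (T : set R) (f : R -> R) (a b : R)
    : R :=
  let F := xget (fun=> 0) [set F : R -> R | delta_antiderivative T F f] in
  F b - F a.

Definition mx_rd_continuous (R : realType) (T : set R) (m n : nat)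
    (F : R -> 'M[R]_(m, n)) : Prop :=
  forall i j, rd_continuous T (fun t => F t i j).

Definition is_mx_delta_derive (R : realType) (T : set R) (m n : nat)
    (F : R -> 'M[R]_(m, n)) (t : R) (D : 'M[R]_(m, n)) : Prop :=
  forall i j, is_delta_derive T (fun s => F s i j) t (D i j).

Definition mx_delta_integral (R : realType) (T : set R) (m n : nat)
    (F : R -> 'M[R]_(m, n)) (a b : R) : 'M[R]_(m, n) :=
  \matrix_(i, j) delta_integral T (fun t => F t i j) a b.

Definition regressive (R : realType) (T : set R) (n : nat)
    (A : R -> 'M[R]_n) : Prop :=
  forall t, T t -> 1%:M + graininess T t *: A t \in unitmx.

Definition transition_solution (R : realType) (T : set R) (n : nat)
    (A : R -> 'M[R]_n) (s : R) (X : R -> 'M[R]_n) : Prop :=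
  (forall t, T t -> is_mx_delta_derive T X t (A t *m X t)) /\ X s = 1%:M.

(* Phi_A(t, s). The solution is unique only as a function on T, so this is
   meaningful for t, s in T. *)
Definition transition_mx (R : realType) (T : set R) (n : nat)
    (A : R -> 'M[R]_n) (t s : R) : 'M[R]_n :=
  xget (fun=> 1%:M) [set X : R -> 'M[R]_n | transition_solution T A s X] t.

Definition system_solution (R : realType) (T : set R) (n m p : nat)
    (A : R -> 'M[R]_n) (B : R -> 'M[R]_(n, m))
    (C : R -> 'M[R]_(p, n)) (D : R -> 'M[R]_(p, m))
    (t0 : R) (x0 : 'cV[R]_n) (u : R -> 'cV[R]_m)
    (x : R -> 'cV[R]_n) (y : R -> 'cV[R]_p) : Prop :=
  [/\ forall t, T t -> is_mx_delta_derive T x t (A t *m x t + B t *m u t),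
      x t0 = x0
    & forall t, T t -> y t = C t *m x t + D t *m u t].

Definition controllable (R : realType) (T : set R) (n m p : nat)
    (A : R -> 'M[R]_n) (B : R -> 'M[R]_(n, m))
    (C : R -> 'M[R]_(p, n)) (D : R -> 'M[R]_(p, m)) (t0 tf : R) : Prop :=
  forall x0 xf : 'cV[R]_n,
  exists2 u : R -> 'cV[R]_m, mx_rd_continuous T u &
  exists x : R -> 'cV[R]_n, exists y : R -> 'cV[R]_p,
    system_solution T A B C D t0 x0 u x y /\ x tf = xf.

Definition controllability_gramian (R : realType) (T : set R) (n m : nat)
    (A : R -> 'M[R]_n) (B : R -> 'M[R]_(n, m)) (t0 tf : R) : 'M[R]_n :=
  mx_delta_integral T
    (fun t => let P := transition_mx T A t0 (forward_jump T t) in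
              P *m B t *m (B t)^T *m P^T) t0 tf.

(* Main.v *)
Require Import Defs.
From HB Require Import structures.
From mathcomp Require Import all_boot all_order all_algebra.
From mathcomp Require Import all_classical all_reals all_analysis.
From mathcomp Require Import ring lra.

Set Implicit Arguments.
Unset Strict Implicit.
Unset Printing Implicit Defensive.

Import Order.TTheory GRing.Theory Num.Theory.
Import numFieldNormedType.Exports.

Local Open Scope classical_set_scope.
Local Open Scope ring_scope.

(* The Gramian is the increment over [t0, tf] of an antiderivative F of K K^T,
   where K t = X(sigma t)^-1 B t and X = Phi_A(., t0).  Writing x = X z turns the
   control system into z^Delta = K u.  If the Gramian is invertible, u = K^T c steers
   z to any target.  If v annihilates it, then v F v^T is nondecreasing with
   increment 0, so v K = 0 on [t0, tf), and v z is the same at both ends for every u.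

   X, and the antiderivatives hidden in the delta integral, are obtained on all of T
   from Euler polygons.  Two statements of the form "P holds for all a <= b in T"
   are reduced by a Cousin-type lemma to short intervals on either side of a point
   and to single jumps: the existence of eps-approximate solutions prescribed at
   either end, and a bound for solutions by their value at any point (regressivity
   enters when a jump is crossed backwards).  The bound makes the approximate
   solutions uniformly Cauchy as eps -> 0. *)

(** The definitions demand solutions on all of [T]: [transition_mx] and [delta_integral] pick
    functions whose derivative is prescribed at every point of [T], and without one the Gramian
    would silently be built from default values. So existence is needed in both time directions and
    beyond [t0, tf].

    At a left-dense point the left limit of a coefficient may differ from its value. Estimates
    therefore use right difference quotients on half-open intervals, together with left continuity;
    this also allows polygon pieces to be glued without any condition on slopes. Derivatives do not
    survive uniform limits, so the limit is characterised by its integral equation and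
    differentiated afterwards.

    The sigma in the Gramian comes from the product rule (X z)^Delta = X^Delta z + X(sigma) z^Delta:
    the factor X(sigma) must cancel against an inverse to leave B u. Invertibility of X and the
    identity X(t)^-1 = Phi_A(t0, t) both follow from uniqueness in either time direction. *)

(** * The entrywise l1 norm of matrices *)

Definition mxn (R : realType) (m n : nat) (A : 'M[R]_(m, n)) : R :=
  \sum_i \sum_j `|A i j|.

Section EntrywiseNorm.
Variable R : realType.
Implicit Types m n p : nat.

Lemma mxn_ge0 m n (A : 'M[R]_(m, n)) : 0 <= mxn A.
Proof. by apply: sumr_ge0 => i _; apply: sumr_ge0. Qed.

Lemma mxn0 m n : mxn (0 : 'M[R]_(m, n)) = 0.
Proof. by rewrite /mxn big1 // => i _; rewrite big1 // => j _; rewrite mxE normr0. Qed.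

Lemma mxnD m n (A B : 'M[R]_(m, n)) : mxn (A + B) <= mxn A + mxn B.
Proof.
rewrite /mxn -big_split; apply: ler_sum => i _.
by rewrite -big_split; apply: ler_sum => j _; rewrite mxE ler_normD.
Qed.

Lemma mxnZ m n (a : R) (A : 'M[R]_(m, n)) : mxn (a *: A) = `|a| * mxn A.
Proof.
rewrite /mxn mulr_sumr; apply: eq_bigr => i _.
by rewrite mulr_sumr; apply: eq_bigr => j _; rewrite mxE normrM.
Qed.

Lemma mxnN m n (A : 'M[R]_(m, n)) : mxn (- A) = mxn A.
Proof. by rewrite -scaleN1r mxnZ normrN1 mul1r. Qed.

Lemma mxnC m n (A B : 'M[R]_(m, n)) : mxn (A - B) = mxn (B - A).
Proof. by rewrite -mxnN opprB. Qed.

Lemma mxnB m n (A B : 'M[R]_(m, n)) : mxn (A - B) <= mxn A + mxn B.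
Proof. by rewrite -(mxnN B); apply: mxnD. Qed.

Lemma mxn_dist_trans m n (B A C : 'M[R]_(m, n)) :
  mxn (A - C) <= mxn (A - B) + mxn (B - C).
Proof. by rewrite -[A - C](subrKA B); apply: mxnD. Qed.

Lemma mxn_le_dist m n (A B : 'M[R]_(m, n)) : mxn A <= mxn (A - B) + mxn B.
Proof. by rewrite -{1}[A](subrK B) mxnD. Qed.

Lemma mxn_entry m n (A : 'M[R]_(m, n)) i j : `|A i j| <= mxn A.
Proof.
rewrite /mxn (bigD1 i) //= (bigD1 j) //= -addrA lerDl addr_ge0 //.
  exact: sumr_ge0.
by apply: sumr_ge0 => k _; apply: sumr_ge0.
Qed.

Lemma mxn_le_entries m n (A : 'M[R]_(m, n)) (e : R) :
  (forall i j, `|A i j| <= e) -> mxn A <= (m * n)%:R * e.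
Proof.
move=> he; apply: (@le_trans _ _ (\sum_(i < m) \sum_(j < n) e)).
  by apply: ler_sum => i _; apply: ler_sum.
rewrite !sumr_const !card_ord -mulrnA mulnC mulr_natl; exact: lexx.
Qed.

Lemma mxn_le0 m n (A : 'M[R]_(m, n)) : mxn A <= 0 -> A = 0.
Proof.
move=> h; apply/matrixP => i j; rewrite mxE; apply/eqP; rewrite -normr_le0.
exact: le_trans (mxn_entry A i j) h.
Qed.

Lemma mxn_tr m n (A : 'M[R]_(m, n)) : mxn A^T = mxn A.
Proof.
rewrite /mxn exchange_big; apply: eq_bigr => i _; apply: eq_bigr => j _.
by rewrite mxE.
Qed.

Lemma mxnM m n p (A : 'M[R]_(m, n)) (B : 'M[R]_(n, p)) :
  mxn (A *m B) <= mxn A * mxn B.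
Proof.
rewrite /mxn mulr_suml; apply: ler_sum => i _.
apply: (@le_trans _ _ (\sum_j \sum_k `|A i k| * `|B k j|)).
  apply: ler_sum => j _; rewrite mxE.
  apply: le_trans (ler_norm_sum _ _ _) _.
  by apply: ler_sum => k _; rewrite normrM.
rewrite exchange_big mulr_suml; apply: ler_sum => k _.
rewrite -mulr_sumr ler_wpM2l // (bigD1 k) //= lerDl.
by apply: sumr_ge0 => l _; apply: sumr_ge0.
Qed.

Lemma mxnM_le m n p (A : 'M[R]_(m, n)) (B : 'M[R]_(n, p)) (a b : R) :
  mxn A <= a -> mxn B <= b -> mxn (A *m B) <= a * b.
Proof. by move=> ha hb; apply: le_trans (mxnM A B) _; rewrite ler_pM ?mxn_ge0. Qed.

Lemma le_eps (x y : R) : (forall e, 0 < e -> x <= y + e) -> x <= y.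
Proof. by move=> h; apply/ler_addgt0Pr. Qed.

(** Completeness with an explicit rate. In each entry every lower estimate x - c e lies below every
    upper estimate x + c e, so the supremum of the lower ones is a limit, within c e of the member
    of index e. *)
Lemma mxn_limit (m n : nat) (x : R -> 'M[R]_(m, n)) (e0 c : R) : 0 < e0 ->
  (forall e e', 0 < e <= e0 -> 0 < e' <= e0 -> mxn (x e - x e') <= c * (e + e')) ->
  exists l, forall e, 0 < e <= e0 -> mxn (x e - l) <= (m * n)%:R * (c * e).
Proof.
move=> e0_gt0 hx.
pose S i j := [set v | exists2 e, 0 < e <= e0 & v = x e i j - c * e].
exists (\matrix_(i, j) sup (S i j)) => e he.
apply: mxn_le_entries => i j; rewrite !mxE.
have entry e1 e2 : 0 < e1 <= e0 -> 0 < e2 <= e0 ->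
    x e1 i j - c * e1 <= x e2 i j + c * e2.
  move=> h1 h2; have := le_trans (mxn_entry _ i j) (hx _ _ h1 h2).
  by rewrite !mxE ler_norml => /andP[_]; rewrite mulrDr; lra.
have ub : ubound (S i j) (x e i j + c * e).
  by move=> _ [e1 h1 ->]; apply: entry.
have h1 : x e i j - c * e <= sup (S i j).
  by apply: ub_le_sup; [exists (x e i j + c * e) | exists e].
have h2 : sup (S i j) <= x e i j + c * e.
  by apply: ge_sup => //; exists (x e i j - c * e); exists e.
by rewrite ler_norml; apply/andP; split; lra.
Qed.

End EntrywiseNorm.

(** * Order structure of a closed set, and induction along it *)

Section TimeScaleOrder.
Variables (R : realType) (T : set R).
Hypothesis Tcl : closed T.
Implicit Types (a b c r s t p : R).

Lemma closed_inf_mem (S : set R) : S `<=` T -> S !=set0 -> has_lbound S -> T (inf S).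
Proof.
move=> ST S0 lb; apply: Tcl => U /nbhs_ballP[e /= e0 eU].
have [x Sx xlt] := inf_adherent e0 (conj S0 lb).
exists x; split; first exact: ST.
apply: eU; rewrite /ball /=.
have h := ge_inf lb Sx; rewrite distrC ger0_norm ?subr_ge0 //.
lra.
Qed.

Lemma closed_sup_mem (S : set R) : S `<=` T -> S !=set0 -> has_ubound S -> T (sup S).
Proof.
move=> ST S0 ub; apply: Tcl => U /nbhs_ballP[e /= e0 eU].
have [x Sx xlt] := sup_adherent e0 (conj S0 ub).
exists x; split; first exact: ST.
apply: eU; rewrite /ball /=.
have := ub_le_sup ub Sx => h; rewrite ger0_norm ?subr_ge0 //.
lra.
Qed.

(** Real induction adapted to [T]. Let [c] be the infimum of the failing points of [a, b];
    closedness puts it in [T]. There [Q] holds, by the limit clause or by stepping over the gap on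
    the left of [c], and then a right step from [c] contradicts the choice of [c]. *)
Lemma ts_induction (Q : R -> Prop) a b : T a -> T b -> a <= b -> Q a ->
  (forall t, T t -> a <= t -> t < b -> Q t ->
     exists r, [/\ T r, t < r & forall s, T s -> t < s -> s <= r -> Q s]) ->
  (forall t, T t -> a < t -> t <= b ->
     (forall p, p < t -> exists2 s, T s & p < s < t) ->
     (forall s, T s -> a <= s -> s < t -> Q s) -> Q t) ->
  Q b.
Proof.
move=> Ta Tb ab Qa hr hl; apply: contrapT => nQb.
pose S := [set t | [/\ T t, a <= t, t <= b & ~ Q t]].
have Sb : S b by [].
have lbS : has_lbound S by exists a => t [].
have ST : S `<=` T by move=> t [].
set c := inf S.
have Tc : T c by apply: closed_inf_mem => //; exists b.
have ac : a <= c by apply: lb_le_inf; [exists b | move=> t []].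
have cb : c <= b by apply: ge_inf.
have Qlt s : T s -> a <= s -> s < c -> Q s.
  move=> Ts as_ sc; apply: contrapT => nQ.
  have : c <= s by apply: ge_inf => //; split=> //; lra.
  lra.
have Qc : Q c.
  have [<- //|ac'] := eqVneq a c.
  have {}ac' : a < c by rewrite lt_neqAle ac'.
  have [lim|] := pselect (forall p, p < c -> exists2 s, T s & p < s < c).
    exact: hl.
  move=> /existsNP[p /not_implyP[pc nex]].
  (* There is a gap on the left of [c], so [sup L] is a point of [T] below [c]. A right step from it
     reaches some [r] in [T] above [sup L], hence at or beyond [c]. *)
  pose L := [set s | T s /\ s < c].
  have La : L a by [].
  have ubL : has_ubound L by exists c => s [_ /ltW].
  have TsL : T (sup L) by apply: closed_sup_mem; [move=> s [] | exists a |].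
  have supLc : sup L < c.
    have h : forall s, L s -> s <= p.
      by move=> s [Ts sc]; rewrite leNgt; apply/negP => ps; apply: nex; exists s; rewrite ?ps.
    by apply: le_lt_trans pc; apply: ge_sup => //; exists a.
  have asup : a <= sup L by apply: ub_le_sup.
  have [r [Tr supr Qr]] := hr _ TsL asup (lt_le_trans supLc cb) (Qlt _ TsL asup supLc).
  have cr : c <= r.
    rewrite leNgt; apply/negP => rc.
    have : r <= sup L by apply: ub_le_sup.
    lra.
  exact: Qr.
have cltb : c < b by rewrite lt_neqAle cb andbT; apply/eqP => cE; apply: nQb; rewrite -cE.
have [r [Tr cr Qr]] := hr _ Tc ac cltb Qc.
have rc0 : 0 < r - c by lra.
have [s [Ts as_ sb nQs] slt] := inf_adherent rc0 (conj (ex_intro _ b Sb) lbS).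
have cs : c <= s by apply: ge_inf.
apply: nQs; have [<- //|cs'] := eqVneq c s.
apply: Qr => //; first by rewrite lt_neqAle cs'.
move: slt; rewrite -/c; lra.
Qed.

(** Induction on the right end with [a] fixed. In the third premise [b] witnesses that [T] continues
    beyond [t]; the fourth can be met vacuously at a left-scattered point, whose gap is bridged by
    the third. *)
Lemma ts_cousin (P : R -> R -> Prop) :
  (forall a, T a -> P a a) ->
  (forall a b c, T a -> T b -> T c -> a <= b -> b <= c -> P a b -> P b c -> P a c) ->
  (forall t b, T t -> T b -> t < b ->
    exists r, [/\ T r, t < r & forall s, T s -> t < s -> s <= r -> P t s]) ->
  (forall t, T t -> exists2 p, p < t & forall s, T s -> p < s -> s < t -> P s t) ->
  forall a b, T a -> T b -> a <= b -> P a b.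
Proof.
move=> refl trans hr hl a b Ta Tb ab.
apply: (@ts_induction (P a) a b) => //; first exact: refl.
- move=> t Tt at_ tb Pt; have [r [Tr tr Pr]] := hr t b Tt Tb tb.
  by exists r; split=> // s Ts ts sr; apply: (trans a t s) => //; [exact: ltW | exact: Pr].
- move=> t Tt at_ tb lim Plt; have [p pt Pp] := hl t Tt.
  have : Num.max a p < t by rewrite gt_max at_.
  move=> /lim[s Ts /andP[]]; rewrite gt_max => /andP[as_ ps] st.
  apply: (trans a s t) => //; [exact: ltW | exact: ltW | | exact: Pp].
  by apply: Plt => //; exact: ltW.
Qed.

Lemma left_cases t : T t ->
  left_dense T t \/ exists2 p, p < t & forall s, T s -> p < s -> s < t -> False.
Proof.
move=> Tt.
have [lim|] := pselect (forall p, p < t -> exists2 s, T s & p < s < t).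
  left; split.
    have [|s Ts /andP[_ st]] := lim (t - 1); first lra.
    by exists s.
  have ubt : ubound [set s | T s /\ s < t] t by move=> s [_ /ltW].
  apply/eqP; rewrite eq_le; apply/andP; split.
    apply: ge_sup => //; have [|s Ts /andP[_ st]] := lim (t - 1); first lra.
    by exists s.
  rewrite leNgt; apply/negP => /lim[s Ts /andP[h st]].
  have : s <= backward_jump T t by apply: ub_le_sup; [exists t | ].
  by rewrite leNgt h.
move=> /existsNP[p /not_implyP[pt nex]]; right; exists p => // s Ts ps st.
by apply: nex; exists s => //; rewrite ps.
Qed.

Hypothesis Tub : unbounded_above T.

Lemma forward_set_nonempty t : [set s | T s /\ t < s] !=set0.
Proof.
apply: contrapT => h; apply: Tub; exists t => s Ts.
by rewrite leNgt; apply/negP => ts; apply: h; exists s.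
Qed.

Lemma forward_set_lbound t : lbound [set s | T s /\ t < s] t.
Proof. by move=> s [_ /ltW]. Qed.

Lemma forward_jump_mem t : T (forward_jump T t).
Proof.
apply: closed_inf_mem; [by move=> s [] | exact: forward_set_nonempty |].
by exists t; exact: forward_set_lbound.
Qed.

Lemma forward_jump_ge t : t <= forward_jump T t.
Proof. by apply: lb_le_inf; [exact: forward_set_nonempty | exact: forward_set_lbound]. Qed.

Lemma forward_jump_le t s : T s -> t < s -> forward_jump T t <= s.
Proof. by move=> Ts ts; apply: ge_inf => //; exists t; exact: forward_set_lbound. Qed.

Lemma right_denseP t : right_dense T t <-> forward_jump T t = t.
Proof.
split=> [[]//|h]; split=> //.
by have [s [Ts ts]] := forward_set_nonempty t; exists s.
Qed.

Lemma right_dense_approx t d : right_dense T t -> 0 < d ->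
  exists r, [/\ T r, t < r & r < t + d].
Proof.
move=> [_ rd] d0.
have hi : has_inf [set s | T s /\ t < s].
  by split; [exact: forward_set_nonempty | exists t; exact: forward_set_lbound].
have [r [Tr tr] rlt] := inf_adherent d0 hi.
by exists r; split=> //; rewrite -[X in X + d]rd.
Qed.

Lemma right_cases t : right_dense T t \/ t < forward_jump T t.
Proof.
have := forward_jump_ge t; rewrite le_eqVlt => /orP[/eqP h|]; [left|by right].
exact/right_denseP.
Qed.

Lemma right_scattered_eq t s r : T s -> forward_jump T t = r -> t <= s -> s < r -> s = t.
Proof.
move=> Ts <- ts sr; apply/eqP; rewrite eq_le ts andbT leNgt; apply/negP => h.
by have := forward_jump_le Ts h; rewrite leNgt sr.
Qed.

End TimeScaleOrder.

(** * Filter-free forms of rd-continuity and of the delta derivative *)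

(** [rdcont] and [hasdelta] treat a matrix as a whole and expose their radii, so that the estimates
    are plain inequalities between norms; [rdcontP] and [hasdeltaP] translate from the entrywise
    definitions. *)
Definition rdcont (R : realType) (T : set R) (m n : nat) (f : R -> 'M[R]_(m, n)) : Prop :=
  (forall t, T t -> right_dense T t -> forall e : R, 0 < e ->
     exists2 d : R, 0 < d & forall s, T s -> `|s - t| < d -> mxn (f s - f t) <= e) /\
  (forall t, T t -> left_dense T t -> exists L, forall e : R, 0 < e ->
     exists2 p : R, p < t & forall s, T s -> p < s -> s < t -> mxn (f s - L) <= e).

Definition hasdelta (R : realType) (T : set R) (m n : nat) (F : R -> 'M[R]_(m, n))
    (t : R) (D : 'M[R]_(m, n)) : Prop :=
  forall e : R, 0 < e -> exists2 d : R, 0 < d & forall s, T s -> `|s - t| < d ->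
    mxn (F (forward_jump T t) - F s - (forward_jump T t - s) *: D)
      <= e * `|forward_jump T t - s|.

Section EpsilonForms.
Variables (R : realType) (T : set R).

Lemma near_withinP t (P : R -> Prop) :
  (\forall s \near within T (nbhs t), P s) <->
  exists2 d, 0 < d & forall s, T s -> `|s - t| < d -> P s.
Proof.
rewrite near_withinE; split.
  move=> /nbhs_ballP[d /= d0 hd]; exists d => // s Ts st; apply: (hd s) => //.
  by rewrite /ball /= distrC.
move=> [d d0 hd]; apply/nbhs_ballP; exists d => // s; rewrite /ball /= => st Ts.
by apply: hd => //; rewrite distrC.
Qed.

Lemma near_within_leftP t (P : R -> Prop) :
  (\forall s \near within T (t^'-), P s) <->
  exists2 p, p < t & forall s, T s -> p < s -> s < t -> P s.
Proof.
rewrite near_withinE /at_left near_withinE; split.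
  move=> /nbhs_ballP[d /= d0 hd]; exists (t - d); first lra.
  move=> s Ts ps st; apply: (hd s) => //.
  by rewrite /ball /= ger0_norm; lra.
move=> [p pt hp]; apply/nbhs_ballP; exists (t - p) => /=; first lra.
move=> s; rewrite /ball /= => hst st Ts; apply: hp => //.
by move: hst; rewrite ger0_norm; lra.
Qed.

(** The successor in the denominator covers empty matrices. The scale [c] is 1 for limits and
    |sigma(t) - s| for delta derivatives. *)
Lemma entry_eps (m n : nat) (e : R) : 0 < e ->
  exists2 e', 0 < e' & forall A : 'M[R]_(m, n),
    forall c, 0 <= c -> (forall i j, `|A i j| <= e' * c) -> mxn A <= e * c.
Proof.
move=> e0; exists (e / (m * n).+1%:R); first by rewrite divr_gt0.
move=> A c c0 /mxn_le_entries h; apply: le_trans h _.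
rewrite mulrA ler_wpM2r // mulrC -mulrA ger_pMr //.
by rewrite mulrC ler_pdivrMr // mul1r ler_nat.
Qed.

Lemma rdcontP (m n : nat) (f : R -> 'M[R]_(m, n)) : mx_rd_continuous T f <-> rdcont T f.
Proof.
split=> [h|[h1 h2] i j].
  split=> t Tt dt.
    move=> e e0; have [e' e'0 he'] := entry_eps m n e0.
    apply/near_withinP; have : \forall s \near within T (nbhs t), forall i j,
        `|f t i j - f s i j| <= e'.
      apply: filter_forall => i; apply: filter_forall => j.
      by have /cvgrPdist_le/(_ _ e'0) := (h i j).1 t Tt dt.
    move=> /near_withinP[d d0 hd]; apply/near_withinP; exists d => // s Ts st.
    rewrite -[e]mulr1; apply: he' => // i j; rewrite !mxE mulr1 distrC.
    exact: hd.
  have /choice[L hL] : forall ij : 'I_m * 'I_n, exists l : R,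
      f s ij.1 ij.2 @[s --> within T (t^'-)] --> l.
    by move=> ij; exact: (h ij.1 ij.2).2 t Tt dt.
  exists (\matrix_(i, j) L (i, j)) => e e0.
  have [e' e'0 he'] := entry_eps m n e0.
  have : \forall s \near within T (t^'-), forall i j, `|L (i, j) - f s i j| <= e'.
    apply: filter_forall => i; apply: filter_forall => j.
    by have /cvgrPdist_le/(_ _ e'0) := hL (i, j).
  move=> /near_within_leftP[p pt hp]; exists p => // s Ts ps st.
  rewrite -[e]mulr1; apply: he' => // i j; rewrite !mxE mulr1 distrC.
  exact: hp.
split=> t Tt dt.
  apply/cvgrPdist_le => e e0; apply/near_withinP.
  have [d d0 hd] := h1 t Tt dt e e0; exists d => // s Ts st.
  apply: le_trans (hd s Ts st); rewrite mxnC.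
  by have := mxn_entry (f t - f s) i j; rewrite !mxE.
have [L hL] := h2 t Tt dt; exists (L i j).
apply/cvgrPdist_le => e e0; apply/near_within_leftP.
have [p pt hp] := hL e e0; exists p => // s Ts ps st.
apply: le_trans (hp s Ts ps st); rewrite mxnC.
by have := mxn_entry (L - f s) i j; rewrite !mxE.
Qed.

Lemma hasdeltaP (m n : nat) (F : R -> 'M[R]_(m, n)) t D :
  is_mx_delta_derive T F t D <-> hasdelta T F t D.
Proof.
split=> h.
  move=> e e0; have [e' e'0 he'] := entry_eps m n e0.
  have : \forall s \near within T (nbhs t), forall i j,
      `|F (forward_jump T t) i j - F s i j - D i j * (forward_jump T t - s)|
         <= e' * `|forward_jump T t - s|.
    by apply: filter_forall => i; apply: filter_forall => j; exact: h.
  move=> /near_withinP[d d0 hd]; exists d => // s Ts st.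
  apply: he' => // i j; rewrite !mxE [(forward_jump T t - s) * _]mulrC.
  exact: hd.
move=> i j e e0; apply/near_withinP; have [d d0 hd] := h e e0.
exists d => // s Ts st; apply: le_trans (hd s Ts st).
by apply: le_trans (mxn_entry _ i j); rewrite !mxE [D i j * _]mulrC.
Qed.

End EpsilonForms.

(* Right difference quotients of [y] at [t] are eventually at most any number
   above [c].  At a right-scattered [t] the witness [r] is [forward_jump T t]. *)
Definition rightlip (R : realType) (T : set R) (m n : nat) (c : R)
    (y : R -> 'M[R]_(m, n)) (t : R) : Prop :=
  forall e : R, c < e -> exists r : R, [/\ T r, t < r &
    forall s, T s -> t < s -> s <= r -> mxn (y s - y t) <= e * (s - t)].

Definition leftcont (R : realType) (T : set R) (m n : nat)
    (y : R -> 'M[R]_(m, n)) (t : R) : Prop :=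
  forall e : R, 0 < e -> exists2 p : R, p < t &
    forall s, T s -> p < s -> s < t -> mxn (y s - y t) <= e.

(** Qualitative regularity with an uncontrolled constant: it provides left continuity and a finite
    supremum, without which the absorption arguments could not start. *)
Definition lip (R : realType) (T : set R) (m n : nat)
    (y : R -> 'M[R]_(m, n)) (a b : R) : Prop :=
  exists2 L : R, 0 <= L & forall s t, T s -> T t -> a <= s -> s <= t -> t <= b ->
    mxn (y t - y s) <= L * (t - s).

(** * A mean value inequality from right difference quotients *)

Section MeanValue.
Variables (R : realType) (T : set R).
Hypothesis Tcl : closed T.
Variables (m n : nat).
Implicit Types (a b c s t : R) (y : R -> 'M[R]_(m, n)).

Lemma rightlip_weaken c c' y t : c <= c' -> rightlip T c y t -> rightlip T c' y t.
Proof. by move=> cc' h e ce; apply: h; exact: le_lt_trans ce. Qed.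

Lemma rightlipD c c' y y' t : rightlip T c y t -> rightlip T c' y' t ->
  rightlip T (c + c') (fun s => y s + y' s) t.
Proof.
move=> h h' e ce.
have [|r [Tr tr hr]] := h (c + (e - c - c') / 2); first lra.
have [|r' [Tr' tr' hr']] := h' (c' + (e - c - c') / 2); first lra.
exists (Num.min r r'); split.
- by rewrite /Num.min; case: ifP.
- by rewrite lt_min tr.
- move=> s Ts ts; rewrite le_min => /andP[sr sr'].
  rewrite opprD addrACA; apply: le_trans (mxnD _ _) _.
  by have := hr s Ts ts sr; have := hr' s Ts ts sr'; lra.
Qed.

Lemma rightlip_congr c y y' t b : T b -> t < b ->
  (forall s, T s -> t <= s -> s <= b -> y s = y' s) -> T t ->
  rightlip T c y t -> rightlip T c y' t.
Proof.
move=> Tb tb yy' Tt h e ce; have [r [Tr tr hr]] := h e ce.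
exists (Num.min r b); split.
- by rewrite /Num.min; case: ifP.
- by rewrite lt_min tr.
- move=> s Ts ts; rewrite le_min => /andP[sr sb].
  by rewrite -(yy' s) ?(ltW ts) // -(yy' t) ?(ltW tb) //; exact: hr.
Qed.

Lemma rightlip_linear (b t : R) (d : 'M[R]_(m, n)) : T b -> t < b ->
  rightlip T (mxn d) (fun s => s *: d) t.
Proof.
move=> Tb tb e de; exists b; split=> // s Ts ts sb.
rewrite -scalerBl mxnZ ger0_norm; last by lra.
by rewrite mulrC ler_wpM2r //; lra.
Qed.

(** A Dini-type mean value theorem. With the strictly larger constant [k] the quotient bound is
    available just to the right of each point; induction then carries |y t - y a| <= k (t - a)
    along, right steps adding up and left continuity passing to left-dense points. *)
Lemma mean_value_inequality c y a b : T a -> T b -> a <= b ->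
  (forall t, T t -> a <= t -> t < b -> rightlip T c y t) ->
  (forall t, T t -> a < t -> t <= b -> leftcont T y t) ->
  mxn (y b - y a) <= c * (b - a).
Proof.
move=> Ta Tb ab hr hl; have [<-|anb] := eqVneq a b.
  by rewrite !subrr mxn0 mulr0.
have ab' : 0 < b - a by rewrite subr_gt0 lt_neqAle anb.
apply: le_eps => e e0.
have -> : c * (b - a) + e = (c + e / (b - a)) * (b - a).
  by rewrite mulrDl divfK // gt_eqF.
set k := c + _.
have ck : c < k by rewrite ltrDl divr_gt0.
apply: (@ts_induction R T Tcl (fun t => mxn (y t - y a) <= k * (t - a)) a b) => //.
- by rewrite !subrr mxn0 mulr0.
- move=> t Tt at_ tb Qt; have [r [Tr tr hr']] := hr t Tt at_ tb k ck.
  exists r; split=> // s Ts ts sr; have := hr' s Ts ts sr.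
  by have := mxn_dist_trans (y t) (y s) (y a); lra.
- move=> t Tt at_ tb lim Qlt; apply: le_eps => d d0.
  (* Nothing is assumed on the sign of [k], so k (s - t) may be positive; taking [s] close to [t]
     relative to 1 + |k| keeps it below d / 2. *)
  have d1 : 0 < d / (1 + `|k|) by rewrite divr_gt0 // ltr_pwDl.
  have d2 : 0 < d / 2 by lra.
  have [p pt hp] := hl t Tt at_ tb _ d2.
  have : Num.max a (Num.max p (t - d / (1 + `|k|) / 2)) < t.
    by rewrite !gt_max at_ pt /=; lra.
  move=> /lim[s Ts /andP[]]; rewrite !gt_max => /and3P[as_ ps ds] st.
  have := hp s Ts ps st; rewrite mxnC => h1.
  have := Qlt s Ts (ltW as_) st => h2.
  have h3 := mxn_dist_trans (y s) (y t) (y a).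
  suff : k * (s - t) <= d / 2 by lra.
  have : k * (s - t) <= `|k| * (t - s).
    apply: le_trans (ler_norm _) _; rewrite normrM distrC (ger0_norm (x := t - s)) //; lra.
  move/le_trans; apply.
  have h4 : t - s <= d / (1 + `|k|) / 2 by lra.
  have -> : d / 2 = (1 + `|k|) * (d / (1 + `|k|) / 2).
    by field; rewrite gt_eqF // ltr_pwDl.
  by rewrite ler_pM //; lra.
Qed.

Lemma lip_leftcont y a b t : lip T y a b -> T t -> a < t -> t <= b -> leftcont T y t.
Proof.
move=> [L L0 hL] Tt at_ tb e e0.
have L1 : 0 < L + 1 by lra.
exists (Num.max a (t - e / (L + 1))).
  by rewrite gt_max at_ ltrBlDr ltrDl divr_gt0.
move=> s Ts; rewrite gt_max => /andP[as_ ps] st; rewrite mxnC.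
apply: le_trans (hL s t Ts Tt (ltW as_) (ltW st) tb) _.
have : (L + 1) * (t - s) <= e by rewrite mulrC -ler_pdivlMr //; lra.
have : 0 <= t - s by lra.
lra.
Qed.

Lemma lip_bounded y a b : T a -> a <= b -> lip T y a b ->
  exists2 K, 0 <= K & forall t, T t -> a <= t -> t <= b -> mxn (y t) <= K.
Proof.
move=> Ta ab [L L0 hL]; exists (L * (b - a) + mxn (y a)).
  by rewrite addr_ge0 ?mxn_ge0 // mulr_ge0 //; lra.
move=> t Tt at_ tb; apply: le_trans (mxn_le_dist _ (y a)) _; rewrite lerD2r.
by apply: le_trans (hL a t Ta Tt (lexx _) at_ tb) _; rewrite ler_wpM2l //; lra.
Qed.

Lemma lip_sub y a b a' b' : a <= a' -> b' <= b -> lip T y a b -> lip T y a' b'.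
Proof.
move=> aa bb [L L0 hL]; exists L => // s t Ts Tt as_ st tb.
by apply: hL => //; lra.
Qed.

Lemma lip_congr y y' a b : (forall t, T t -> a <= t -> t <= b -> y t = y' t) ->
  lip T y a b -> lip T y' a b.
Proof.
move=> yy' [L L0 hL]; exists L => // s t Ts Tt as_ st tb.
rewrite -!yy' //; first exact: hL.
- exact: le_trans st tb.
- exact: le_trans as_ st.
Qed.

Lemma lip_cat y a b c : T b -> lip T y a b -> lip T y b c -> lip T y a c.
Proof.
move=> Tb [L L0 hL] [L' L'0 hL']; exists (L + L'); first exact: addr_ge0.
move=> s t Ts Tt as_ st tc.
have st0 : 0 <= t - s by lra.
have [tb|bt] := leP t b.
  have := hL s t Ts Tt as_ st tb; have := mulr_ge0 L'0 st0; lra.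
have [bs|sb] := leP b s.
  have := hL' s t Ts Tt bs st tc; have := mulr_ge0 L0 st0; lra.
have h1 := hL s b Ts Tb as_ (ltW sb) (lexx _).
have h2 := hL' b t Tb Tt (lexx _) (ltW bt) tc.
have h3 := mxn_dist_trans (y b) (y t) (y s).
have b1 : 0 <= t - b by lra.
have b2 : 0 <= b - s by lra.
have := mulr_ge0 L0 b1; have := mulr_ge0 L'0 b2; lra.
Qed.

End MeanValue.

(** * Local and global bounds for rd-continuous functions *)

Section RdContinuity.
Variables (R : realType) (T : set R).
Hypotheses (Tcl : closed T) (Tub : unbounded_above T).
Implicit Types (a b c e s t r : R) (m n p : nat).

(** The interval is half-open so that at a right-scattered point only [s = t] remains: a jump of any
    size then counts as an interval of small oscillation. *)
Lemma rdcont_right m n (f : R -> 'M[R]_(m, n)) t e : rdcont T f -> T t -> 0 < e ->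
  exists r, [/\ T r, t < r & forall s, T s -> t <= s -> s < r -> mxn (f s - f t) <= e].
Proof.
move=> [hf _] Tt e0; have [rd|tj] := right_cases Tub t.
  have [d d0 hd] := hf t Tt rd e e0.
  have [r [Tr tr rd']] := right_dense_approx Tub rd d0.
  exists r; split=> // s Ts ts sr; apply: hd => //; rewrite ger0_norm; lra.
exists (forward_jump T t); split=> //; first exact: forward_jump_mem.
move=> s Ts ts sj; rewrite (@right_scattered_eq R T t s _ Ts erefl) //.
by rewrite subrr mxn0 ltW.
Qed.

Lemma rdcont_left m n (f : R -> 'M[R]_(m, n)) t e : rdcont T f -> T t -> 0 < e ->
  exists L, exists2 p, p < t & forall s, T s -> p < s -> s < t -> mxn (f s - L) <= e.
Proof.
move=> [_ hf] Tt e0; have [ld|[p pt np]] := left_cases Tt.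
  by have [L hL] := hf t Tt ld; exists L; exact: hL.
by exists 0, p => // s Ts ps st; have := np s Ts ps st.
Qed.

(** Half-open intervals suit both local statements: to the left of a point [f] is controlled by its
    left limit, which says nothing about the value at the point itself. *)
Lemma rdcont_bounded m n (f : R -> 'M[R]_(m, n)) a b : rdcont T f -> T a -> T b -> a <= b ->
  exists2 K, 0 <= K & forall t, T t -> a <= t -> t < b -> mxn (f t) <= K.
Proof.
move=> hf; move: a b; apply: (ts_cousin Tcl).
- by move=> a _; exists 0 => // t _; lra.
- move=> a b c Ta Tb Tc ab bc [K K0 hK] [K' K'0 hK'].
  exists (K + K'); first exact: addr_ge0.
  move=> t Tt at_ tc; have [bt|tb] := leP b t.
    by have := hK' t Tt bt tc; lra.
  by have := hK t Tt at_ tb; lra.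
- move=> t _ Tt _ _; have [r [Tr tr hr]] := rdcont_right hf Tt ltr01.
  exists r; split=> // s Ts ts sr; exists (1 + mxn (f t)).
    by rewrite addr_ge0 ?mxn_ge0.
  move=> u Tu tu us; apply: le_trans (mxn_le_dist _ (f t)) _.
  by rewrite lerD2r; apply: hr => //; exact: lt_le_trans sr.
- move=> t Tt; have [L [p pt hp]] := rdcont_left hf Tt ltr01.
  exists p => // s Ts ps st; exists (1 + mxn L).
    by rewrite addr_ge0 ?mxn_ge0.
  move=> u Tu su ut; apply: le_trans (mxn_le_dist _ L) _.
  by rewrite lerD2r; apply: hp => //; exact: lt_le_trans su.
Qed.

Lemma small_step (x y : R) : 0 <= x -> 0 < y -> exists2 d, 0 < d & d * x <= y.
Proof.
move=> x0 y0; have x1 : 0 < x + 1 by lra.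
exists (y / (x + 1)); first by rewrite divr_gt0.
by rewrite -mulrA ger_pMr // mulrC ler_pdivrMr //; lra.
Qed.

End RdContinuity.

(* A priori bound for perturbations of [y^Delta = A y], from either end of [a, b];
   [eta] is an absolute and [eps] a relative error. *)
Definition stable (R : realType) (T : set R) (n k : nat) (A : R -> 'M[R]_n) (a b : R) :=
  exists K eps0 : R, [/\ 0 <= K, 0 < eps0 &
   forall (eta eps : R) (y : R -> 'M[R]_(n, k)), 0 <= eta -> 0 <= eps -> eps <= eps0 ->
     lip T y a b ->
     (forall t, T t -> a <= t -> t < b ->
        rightlip T (eta + eps * mxn (y t)) (fun s => y s - s *: (A t *m y t)) t) ->
     forall c t, T c -> T t -> a <= c -> c <= b -> a <= t -> t <= b ->
     mxn (y t) <= K * (mxn (y c) + eta)].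

(** * The a priori bound for perturbed homogeneous equations *)

Section Stability.
Variables (R : realType) (T : set R).
Hypotheses (Tcl : closed T) (Tub : unbounded_above T).
Variables (n k : nat) (A : R -> 'M[R]_n).
Hypotheses (Ard : rdcont T A) (Areg : regressive T A).
Implicit Types (a b c e s t r M eta eps : R).

(** Absorption into the supremum S of |y|. Slopes are at most q = eta + (M + 1) S, so S <= |y c| + q
    (b - a), and the smallness condition leaves at most S / 2 on the right; hence the factor 2. The
    mean value inequality is symmetric in its two ends, so [c] may lie anywhere. *)
Lemma stable_small a b M eta eps (y : R -> 'M[R]_(n, k)) : T a -> T b -> a <= b ->
  0 <= M -> (forall t, T t -> a <= t -> t < b -> mxn (A t) <= M) ->
  (b - a) * (M + 1) <= 1 / 2 -> 0 <= eta -> 0 <= eps -> eps <= 1 ->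
  lip T y a b ->
  (forall t, T t -> a <= t -> t < b ->
    rightlip T (eta + eps * mxn (y t)) (fun s => y s - s *: (A t *m y t)) t) ->
  forall c t, T c -> T t -> a <= c -> c <= b -> a <= t -> t <= b ->
  mxn (y t) <= 2 * (mxn (y c) + eta * (b - a)).
Proof.
move=> Ta Tb ab M0 hM small eta0 eps0 eps1 ly hy c t Tc Tt ac cb at_ tb.
have [B B0 hB] := lip_bounded Ta ab ly.
pose S := [set v | exists u, [/\ T u, a <= u, u <= b & v = mxn (y u)]].
have ubS : has_ubound S by exists B => _ [u [Tu au ub ->]]; exact: hB.
have leS u : T u -> a <= u -> u <= b -> mxn (y u) <= sup S.
  by move=> Tu au ub; apply: ub_le_sup => //; exists u.
have S0 : 0 <= sup S by apply: le_trans (mxn_ge0 (y a)) (leS a Ta (lexx _) ab).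
pose q := eta + (M + 1) * sup S.
have q0 : 0 <= q by rewrite addr_ge0 // mulr_ge0 //; lra.
have MV u v : T u -> T v -> a <= u -> u <= v -> v <= b -> mxn (y v - y u) <= q * (b - a).
  move=> Tu Tv au uv vb; apply: (@le_trans _ _ (q * (v - u))); last first.
    by rewrite ler_wpM2l //; lra.
  apply: (mean_value_inequality Tcl) => // w Tw uw wv.
    have wb : w < b by exact: lt_le_trans vb.
    have aw : a <= w by exact: le_trans uw.
    apply: (@rightlip_congr _ _ _ _ _
      (fun s => (y s - s *: (A w *m y w)) + s *: (A w *m y w)) _ _ b) => //.
      by move=> s _ _ _; rewrite subrK.
    apply: (rightlip_weaken _ (rightlipD (hy w Tw aw wb) (rightlip_linear Tb wb))).
    have h1 := leS w Tw aw (ltW wb).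
    have := mxnM_le (hM w Tw aw wb) h1.
    have := ler_pM eps0 (mxn_ge0 (y w)) eps1 h1.
    rewrite /q; lra.
  by apply: (lip_leftcont ly) => //; [exact: le_lt_trans uw | exact: le_trans vb].
have MVc u : T u -> a <= u -> u <= b -> mxn (y u) <= mxn (y c) + q * (b - a).
  move=> Tu au ub; rewrite addrC; apply: le_trans (mxn_le_dist _ (y c)) _; rewrite lerD2r.
  have [cu|/ltW uc] := leP c u; first exact: MV.
  by rewrite mxnC; exact: MV.
have : sup S <= mxn (y c) + q * (b - a).
  apply: ge_sup; first by exists (mxn (y a)), a.
  by move=> _ [u [Tu au ub ->]]; exact: MVc.
have := leS t Tt at_ tb.
have := ler_wpM2r S0 small.
rewrite /q; lra.
Qed.

(** Across a jump y(sigma t) equals P y(t) up to (eta + eps |y t|) mu, with P = 1 + mu A. Backwards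
    [P] is inverted, and the term eps |y t| has to be absorbed; this is what the threshold [eps0] in
    [stable] is for. *)
Lemma stable_jump t : T t -> t < forward_jump T t -> stable T k A t (forward_jump T t).
Proof.
move=> Tt tj; set r := forward_jump T t.
pose P := 1%:M + (r - t) *: A t.
have Pu : P \in unitmx by exact: Areg.
pose Q := mxn (invmx P); have Q0 : 0 <= Q by exact: mxn_ge0.
have P0 : 0 <= mxn P by exact: mxn_ge0.
pose mu := r - t; have mu0 : 0 < mu by rewrite subr_gt0.
have Qmu : 0 <= Q * mu by rewrite mulr_ge0 // ltW.
(* For eps <= d the backward error Q mu eps |y t| is at most |y t| / 2. *)
have [d d0 hd] := @small_step R (Q * mu) (1 / 2) Qmu ltac:(lra).
(* The sum of the three possible constants: 1 for equal points, 2 Q (1 + mu) backwards ([h4]), and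
   |P| + mu forwards ([h5]). *)
exists (1 + 2 * Q * (1 + mu) + mxn P + mu), (Num.min 1 d); split.
- have := mulr_ge0 Q0 (ltW mu0); lra.
- by rewrite lt_min ltr01.
move=> eta eps y eta0 eps0; rewrite le_min => /andP[eps1 epsd] ly hy.
have Tr : T r by exact: forward_jump_mem.
have hw : mxn (y r - P *m y t) <= (eta + eps * mxn (y t)) * mu.
  (* Any witness of [rightlip] at [t] lies at or beyond sigma(t), so the quotient bound may be
     tested at [r] itself. *)
  rewrite mulrC -ler_pdivrMl //; apply: le_eps => e e0; rewrite ler_pdivrMl // mulrC.
  have [|r' [Tr' tr' hr']] := hy t Tt (lexx _) tj (eta + eps * mxn (y t) + e).
    by rewrite ltrDl.
  have := hr' r Tr tj (forward_jump_le Tr' tr').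
  have -> // : y r - r *: (A t *m y t) - (y t - t *: (A t *m y t)) = y r - P *m y t.
  by rewrite mulmxDl mul1mx -scalemxAl scalerBl !opprD !opprK addrACA -addrA.
have yt0 := mxn_ge0 (y t); have yr0 := mxn_ge0 (y r).
have h1 : mxn (y r) <= mxn P * mxn (y t) + (eta + eps * mxn (y t)) * mu.
  apply: le_trans (mxn_le_dist _ (P *m y t)) _.
  by rewrite [leRHS]addrC; apply: lerD => //; exact: mxnM.
have h2 : mxn (y t) <= Q * (mxn (y r) + (eta + eps * mxn (y t)) * mu).
  rewrite -{1}[y t](mulKmx Pu); apply: mxnM_le => //.
  by apply: le_trans (mxn_le_dist _ (y r)) _; rewrite mxnC addrC lerD2l.
have h3 : Q * mu * eps * mxn (y t) <= mxn (y t) / 2.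
  rewrite mulrC; apply: ler_wpM2l => //.
  have := ler_wpM2l Qmu epsd; lra.
have h4 : mxn (y t) <= 2 * Q * (1 + mu) * (mxn (y r) + eta).
  have := mulr_ge0 Qmu yr0; have := mulr_ge0 Q0 eta0; lra.
have h5 : mxn (y r) <= (mxn P + mu) * (mxn (y t) + eta).
  have := mulr_ge0 P0 eta0.
  have := ler_wpM2r (ltW mu0) (ler_wpM2r yt0 eps1); lra.
have dich s : T s -> t <= s -> s <= r -> s = t \/ s = r.
  move=> Ts ts; rewrite le_eqVlt => /orP[/eqP|sr]; [by right | left].
  exact: (@right_scattered_eq _ T t s r).
have bd : 0 <= 2 * Q * (1 + mu) by rewrite !mulr_ge0 //; lra.
have z1 : 0 <= mxn (y t) + eta by lra.
have z2 : 0 <= mxn (y r) + eta by lra.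
have := mulr_ge0 P0 z1; have := mulr_ge0 P0 z2.
have := mulr_ge0 (ltW mu0) z1; have := mulr_ge0 (ltW mu0) z2.
have := mulr_ge0 bd z1; have := mulr_ge0 bd z2.
move=> g1 g2 g3 g4 g5 g6 c s Tc Ts tc cr ts sr.
by have [->|->] := dich c Tc tc cr; have [->|->] := dich s Ts ts sr; lra.
Qed.

Lemma stable_near_right t : T t ->
  exists r, [/\ T r, t < r & forall s, T s -> t < s -> s <= r -> stable T k A t s].
Proof.
move=> Tt; have [rd|tj] := right_cases Tub t; last first.
  exists (forward_jump T t); split=> //; first exact: forward_jump_mem.
  move=> s Ts ts sj; have -> : s = forward_jump T t.
    by apply/eqP; rewrite eq_le sj forward_jump_le.
  exact: stable_jump.
have [r [Tr tr hr]] := rdcont_right Tcl Tub Ard Tt ltr01.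
pose M := mxn (A t) + 1; have M0 : 0 <= M + 1 by have := mxn_ge0 (A t); rewrite /M; lra.
have [d d0 hd] := @small_step R (M + 1) (1 / 2) M0 ltac:(lra).
have [r' [Tr' tr' rd']] := right_dense_approx Tub rd d0.
exists (Num.min r r'); split.
- by rewrite /Num.min; case: ifP.
- by rewrite lt_min tr.
move=> s Ts ts; rewrite le_min => /andP[sr sr'].
exists (2 * (1 + (s - t))), 1; split=> //; first lra.
move=> eta eps y eta0 eps0 eps1 ly hy c u Tc Tu tc cs tu us.
apply: le_trans (@stable_small t s M eta eps y Tt Ts (ltW ts) _ _ _
  eta0 eps0 eps1 ly hy c u Tc Tu tc cs tu us) _.
- by rewrite /M addr_ge0 ?mxn_ge0.
- move=> w Tw tw ws; rewrite /M addrC; apply: le_trans (mxn_le_dist _ (A t)) _.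
  by rewrite lerD2r; apply: hr => //; exact: lt_le_trans sr.
- have : (s - t) * (M + 1) <= d * (M + 1) by apply: ler_wpM2r => //; lra.
  lra.
- have st0 : 0 <= s - t by lra.
  have := mulr_ge0 st0 (mxn_ge0 (y c)); lra.
Qed.

(** A bound on [A] near its left limit suffices, since [stable] tests slopes only before the right
    end. Jumps inside a short interval are harmless: the smallness of its length absorbs their
    graininess. *)
Lemma stable_near_left t : T t ->
  exists2 p, p < t & forall s, T s -> p < s -> s < t -> stable T k A s t.
Proof.
move=> Tt; have [L [p pt hp]] := rdcont_left Ard Tt ltr01.
pose M := mxn L + 1; have M0 : 0 <= M + 1 by have := mxn_ge0 L; rewrite /M; lra.
have [d d0 hd] := @small_step R (M + 1) (1 / 2) M0 ltac:(lra).
exists (Num.max p (t - d)); first by rewrite gt_max pt; lra.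
move=> s Ts; rewrite gt_max => /andP[ps ds] st.
exists (2 * (1 + (t - s))), 1; split=> //; first lra.
move=> eta eps y eta0 eps0 eps1 ly hy c u Tc Tu sc ct su ut.
apply: le_trans (@stable_small s t M eta eps y Ts Tt (ltW st) _ _ _
  eta0 eps0 eps1 ly hy c u Tc Tu sc ct su ut) _.
- by rewrite /M addr_ge0 ?mxn_ge0.
- move=> w Tw sw wt; rewrite /M addrC; apply: le_trans (mxn_le_dist _ L) _.
  by rewrite lerD2r; apply: hp => //; exact: lt_le_trans sw.
- have : (t - s) * (M + 1) <= d * (M + 1) by apply: ler_wpM2r => //; lra.
  lra.
- have st0 : 0 <= t - s by lra.
  have := mulr_ge0 st0 (mxn_ge0 (y c)); lra.
Qed.

Lemma stable_itv a b : T a -> T b -> a <= b -> stable T k A a b.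
Proof.
move: a b; apply: (ts_cousin Tcl).
- move=> a Ta; exists 1, 1; split=> // eta eps y eta0 _ _ _ _ c t _ _ ac ca at_ ta.
  have -> : t = c by apply/eqP; rewrite eq_le; apply/andP; split; lra.
  by rewrite mul1r lerDl.
- move=> a b c Ta Tb Tc ab bc [K [e0 [K0 e00 hK]]] [K' [e0' [K'0 e0'0 hK']]].
  (* Two points on the same side of [b] cost K or K'; crossing [b] costs K K' plus K or K', because
     eta enters a second time. *)
  exists (K + K' + K * K' + K * K'), (Num.min e0 e0'); split.
  + by rewrite !addr_ge0 ?mulr_ge0.
  + by rewrite lt_min e00.
  move=> eta eps y eta0 eps0; rewrite le_min => /andP[ee0 ee0'] ly hy.
  have h1 : forall u t, T u -> T t -> a <= u -> u <= b -> a <= t -> t <= b ->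
      mxn (y t) <= K * (mxn (y u) + eta).
    apply: (hK eta eps y) => //; first exact: lip_sub ly.
    by move=> t Tt at_ tb; apply: hy => //; exact: lt_le_trans bc.
  have h2 : forall u t, T u -> T t -> b <= u -> u <= c -> b <= t -> t <= c ->
      mxn (y t) <= K' * (mxn (y u) + eta).
    apply: (hK' eta eps y) => //; first exact: lip_sub ly.
    by move=> t Tt bt tc; apply: hy => //; exact: le_trans bt.
  move=> u t Tu Tt au uc at_ tc.
  have z : 0 <= mxn (y u) + eta by rewrite addr_ge0 ?mxn_ge0.
  have := mulr_ge0 K0 z; have := mulr_ge0 K'0 z; have := mulr_ge0 (mulr_ge0 K0 K'0) z.
  have [tb|/ltW bt] := leP t b; have [ub|/ltW bu] := leP u b => g1 g2 g3.
  + have := h1 u t Tu Tt au ub at_ tb; lra.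
  + have := h1 b t Tb Tt ab (lexx _) at_ tb.
    have := ler_wpM2l K0 (h2 u b Tu Tb bu uc (lexx _) bc).
    have : K * eta <= K * (mxn (y u) + eta) by rewrite ler_wpM2l // lerDr mxn_ge0.
    lra.
  + have := h2 b t Tb Tt (lexx _) bc bt tc.
    have := ler_wpM2l K'0 (h1 u b Tu Tb au ub ab (lexx _)).
    have : K' * eta <= K' * (mxn (y u) + eta) by rewrite ler_wpM2l // lerDr mxn_ge0.
    lra.
  + have := h2 u t Tu Tt bu uc bt tc; lra.
- by move=> t _ Tt _ _; exact: stable_near_right.
- exact: stable_near_left.
Qed.

End Stability.

(* Approximate solutions of [X^Delta = A X + G] on [a, b].  The error is relative,
   so that the step sizes of Euler's scheme do not depend on the initial value. *)
Definition approx (R : realType) (T : set R) (n k : nat) (A : R -> 'M[R]_n)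
    (G : R -> 'M[R]_(n, k)) (eps : R) (X : R -> 'M[R]_(n, k)) (a b : R) : Prop :=
  lip T X a b /\ forall t, T t -> a <= t -> t < b ->
    rightlip T (eps * (1 + mxn (X t))) (fun s => X s - s *: (A t *m X t + G t)) t.

(** * Euler polygons prescribed at either end *)

Section Euler.
Variables (R : realType) (T : set R).
Hypotheses (Tcl : closed T) (Tub : unbounded_above T).
Variables (n k : nat) (A : R -> 'M[R]_n) (G : R -> 'M[R]_(n, k)).
Hypotheses (Ard : rdcont T A) (Grd : rdcont T G) (Areg : regressive T A).
Implicit Types (a b c e s t r M eps d : R) (X : R -> 'M[R]_(n, k)).

(** The anchor [c] is free, so that the same kind of piece can be prescribed at its left or at its
    right end. *)
Lemma approx_affine eps a b c (x v : 'M[R]_(n, k)) : T b ->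
  (forall t, T t -> a <= t -> t < b ->
    mxn (v - (A t *m (x + (t - c) *: v) + G t)) <= eps * (1 + mxn (x + (t - c) *: v))) ->
  approx T A G eps (fun s => x + (s - c) *: v) a b.
Proof.
move=> Tb hv; split.
  exists (mxn v); first exact: mxn_ge0.
  move=> s t Ts Tt as_ st tb.
  have -> : x + (t - c) *: v - (x + (s - c) *: v) = (t - s) *: v.
    by apply/matrixP => i j; rewrite !mxE; ring.
  by rewrite mxnZ mulrC ger0_norm //; lra.
move=> t Tt at_ tb e he; exists b; split=> // s Ts ts sb.
set D := A t *m _ + G t.
have -> : x + (s - c) *: v - s *: D - (x + (t - c) *: v - t *: D) = (s - t) *: (v - D).
  rewrite scalerBr !scalerBl !opprB !opprD !opprK; apply/matrixP => i j; rewrite !mxE; ring.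
rewrite mxnZ mulrC ger0_norm; last by lra.
apply: ler_wpM2r; first lra.
by apply: le_trans (ltW he); exact: hv.
Qed.

(** At the node [b] only quotients to the right are tested, so agreement of values is enough and the
    slopes may differ. *)
Lemma approx_cat eps X X' a b c : T b -> a <= b -> b <= c -> X b = X' b ->
  approx T A G eps X a b -> approx T A G eps X' b c ->
  approx T A G eps (fun s => if s <= b then X s else X' s) a c.
Proof.
move=> Tb ab bc Xb [lX hX] [lX' hX']; set Z := fun s => _.
have ZX s : s <= b -> Z s = X s by rewrite /Z => ->.
have ZX' s : b <= s -> Z s = X' s.
  rewrite /Z; case: ifP => // sb bs.
  by have -> : s = b by apply/eqP; rewrite eq_le sb.
split.
  apply: (lip_cat Tb).
    by apply: lip_congr lX => t _ _ tb; rewrite ZX.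
  by apply: lip_congr lX' => t _ bt _; rewrite ZX'.
move=> t Tt at_ tc; have [bt|tb] := leP b t.
  move=> e; rewrite ZX' // => /(hX' t Tt bt tc)[r [Tr tr hr]].
  exists r; split=> // s Ts ts sr; rewrite !ZX' //; [exact: hr | exact: le_trans (ltW ts)].
apply: (@rightlip_congr _ _ _ _ _ (fun s => X s - s *: (A t *m Z t + G t)) _ _ b) => //.
  by move=> s Ts ts sb; rewrite (ZX s).
by rewrite (ZX t) ?(ltW tb) //; exact: hX.
Qed.

(** Quantifying over [x] after the interval is what allows chaining: the value where one piece ends
    is prescribed to the next one. *)
Definition approx_exists eps a b := forall x : 'M[R]_(n, k),
  (exists2 X, approx T A G eps X a b & X a = x) /\
  (exists2 X, approx T A G eps X a b & X b = x).

(** One affine piece of slope A0 x + G0, where [A0] and [G0] stand for values or left limits. Its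
    slope error is at most (e + (b - a) (M + e) M) (1 + |x|), the second summand coming from the
    drift of X away from x. The condition (b - a) M <= 1 / 2 gives 1 + |x| <= 2 (1 + |X|), which
    makes the error relative to X. *)
Lemma approx_exists_small eps a b e M (A0 : 'M[R]_n) (G0 : 'M[R]_(n, k)) :
  T b -> a <= b -> 0 <= M -> 0 <= e -> 0 <= eps -> mxn A0 <= M -> mxn G0 <= M ->
  (forall t, T t -> a <= t -> t < b -> mxn (A t - A0) <= e) ->
  (forall t, T t -> a <= t -> t < b -> mxn (G t - G0) <= e) ->
  (b - a) * M <= 1 / 2 -> e + (b - a) * ((M + e) * M) <= eps / 2 ->
  approx_exists eps a b.
Proof.
move=> Tb ab M0 e0 eps0 hA0 hG0 hA hG small1 small2.
have main c x : a <= c -> c <= b ->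
    approx T A G eps (fun s => x + (s - c) *: (A0 *m x + G0)) a b.
  move=> ac cb; apply: approx_affine => // t Tt at_ tb.
  set v := A0 *m x + G0; set X := x + _.
  have x0 := mxn_ge0 x.
  have hv : mxn v <= M * (1 + mxn x).
    rewrite mulrDr mulr1 addrC; apply: le_trans (mxnD _ _) _; apply: lerD => //.
    exact: mxnM_le.
  have hAt : mxn (A t) <= M + e.
    rewrite addrC; apply: le_trans (mxn_le_dist _ A0) _; apply: lerD => //; exact: hA.
  have tc : `|t - c| <= b - a by rewrite ler_norml; apply/andP; split; lra.
  have htcv : mxn ((t - c) *: v) <= (b - a) * (M * (1 + mxn x)).
    by rewrite mxnZ; apply: ler_pM => //; exact: mxn_ge0.
  have hX : mxn x <= mxn X + (b - a) * (M * (1 + mxn x)).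
    rewrite addrC; apply: le_trans (mxn_le_dist x X) _; rewrite lerD2r mxnC.
    by rewrite /X addrAC subrr add0r.
  have x1 : 0 <= 1 + mxn x by lra.
  have hX2 : 1 + mxn x <= 2 * (1 + mxn X).
    by have := ler_wpM2r x1 small1; lra.
  have -> : v - (A t *m X + G t) = ((A0 - A t) *m x + (G0 - G t)) - A t *m ((t - c) *: v).
    rewrite /X mulmxDr mulmxBl {1}/v.
    move: (A0 *m x) (A t *m x) (A t *m ((t - c) *: v)) => u1 u2 u3.
    by apply/matrixP => i j; rewrite !mxE; ring.
  apply: (@le_trans _ _ (eps / 2 * (1 + mxn x))); last first.
    by have := ler_wpM2l eps0 hX2; lra.
  apply: le_trans (ler_wpM2r x1 small2).
  apply: le_trans (mxnB _ _) _.
  have h1 : mxn ((A0 - A t) *m x) <= e * mxn x.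
    by apply: mxnM_le => //; rewrite mxnC; exact: hA.
  have h2 : mxn (G0 - G t) <= e by rewrite mxnC; exact: hG.
  have h3 := mxnM_le hAt htcv.
  have h4 := mxnD ((A0 - A t) *m x) (G0 - G t).
  lra.
move=> x; split.
  by eexists; [exact: (main a x) | rewrite /= subrr scale0r addr0].
by eexists; [exact: (main b x) | rewrite /= subrr scale0r addr0].
Qed.

(** The slope is tested only at [t], where that of the affine piece is exact. To prescribe the right
    end, P x' = x - mu G(t) is solved for the left value, by regressivity. *)
Lemma approx_exists_jump eps t : T t -> t < forward_jump T t -> 0 <= eps ->
  approx_exists eps t (forward_jump T t).
Proof.
move=> Tt tj eps0; set r := forward_jump T t.
have Tr : T r by exact: forward_jump_mem.
have main x : approx T A G eps (fun s => x + (s - t) *: (A t *m x + G t)) t r.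
  apply: approx_affine => // s Ts ts sr.
  have -> : s = t by exact: (@right_scattered_eq _ T t s r).
  rewrite subrr scale0r addr0 subrr mxn0 mulr_ge0 // addr_ge0 //.
  exact: mxn_ge0.
pose P := 1%:M + (r - t) *: A t.
have Pu : P \in unitmx by exact: Areg.
move=> x; split.
  by eexists; [exact: (main x) | rewrite /= subrr scale0r addr0].
pose x' := invmx P *m (x - (r - t) *: G t).
exists (fun s => x' + (s - t) *: (A t *m x' + G t)); first exact: main.
have : P *m x' = x - (r - t) *: G t by rewrite mulKVmx.
by rewrite mulmxDl mul1mx -scalemxAl scalerDr addrA => ->; rewrite subrK.
Qed.

(** Oscillation of the coefficients is allowed eps / 4; the step length is chosen so that the drift
    uses at most the other eps / 4. *)
Lemma approx_step eps M : 0 < eps -> 0 <= M -> exists d, [/\ 0 < d, d * M <= 1 / 2 &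
   eps / 4 + d * ((M + eps / 4) * M) <= eps / 2].
Proof.
move=> e0 M0; have Q0 : 0 <= (M + eps / 4) * M by rewrite mulr_ge0 //; lra.
have [d d0 hd] := @small_step R M (1 / 2) M0 ltac:(lra).
have [d' d'0 hd'] := @small_step R _ (eps / 4) Q0 ltac:(lra).
exists (Num.min d d'); split; first by rewrite lt_min d0.
  by apply: le_trans hd; apply: ler_wpM2r => //; rewrite ge_min lexx.
have : Num.min d d' * ((M + eps / 4) * M) <= d' * ((M + eps / 4) * M).
  by apply: ler_wpM2r => //; rewrite ge_min lexx orbT.
lra.
Qed.

Lemma approx_exists_near_right eps t : 0 < eps -> T t ->
  exists r, [/\ T r, t < r & forall s, T s -> t < s -> s <= r -> approx_exists eps t s].
Proof.
move=> eps0 Tt; have [rd|tj] := right_cases Tub t; last first.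
  exists (forward_jump T t); split=> //; first exact: forward_jump_mem.
  move=> s Ts ts sj; have -> : s = forward_jump T t.
    by apply/eqP; rewrite eq_le sj forward_jump_le.
  by apply: approx_exists_jump => //; exact: ltW.
have e0 : 0 < eps / 4 by lra.
have [r [Tr tr hr]] := rdcont_right Tcl Tub Ard Tt e0.
have [r' [Tr' tr' hr']] := rdcont_right Tcl Tub Grd Tt e0.
have nA := mxn_ge0 (A t); have nG := mxn_ge0 (G t).
have [d [d0 hd hd']] := approx_step eps0 (addr_ge0 nA nG).
have [r'' [Tr'' tr'' rd'']] := right_dense_approx Tub rd d0.
exists (Num.min r (Num.min r' r'')); split.
- by rewrite /Num.min; case: ifP => // _; case: ifP.
- by rewrite !lt_min tr tr'.
move=> s Ts ts; rewrite !le_min => /and3P[sr sr' sr''].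
have sd : s - t <= d by lra.
apply: (@approx_exists_small eps t s (eps / 4) (mxn (A t) + mxn (G t)) (A t) (G t)) => //; try lra.
- by move=> u Tu tu us; apply: hr => //; exact: lt_le_trans sr.
- by move=> u Tu tu us; apply: hr' => //; exact: lt_le_trans sr'.
- by apply: le_trans hd; apply: ler_wpM2r => //; exact: addr_ge0.
- apply: le_trans hd'; rewrite lerD2l; apply: ler_wpM2r => //.
  by rewrite mulr_ge0 // ?addr_ge0 //; lra.
Qed.

Lemma approx_exists_near_left eps t : 0 < eps -> T t ->
  exists2 p, p < t & forall s, T s -> p < s -> s < t -> approx_exists eps s t.
Proof.
move=> eps0 Tt; have e0 : 0 < eps / 4 by lra.
have [A0 [p pt hp]] := rdcont_left Ard Tt e0.
have [G0 [p' pt' hp']] := rdcont_left Grd Tt e0.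
have nA := mxn_ge0 A0; have nG := mxn_ge0 G0.
have [d [d0 hd hd']] := approx_step eps0 (addr_ge0 nA nG).
exists (Num.max p (Num.max p' (t - d))).
  by rewrite !gt_max pt pt' /=; lra.
move=> s Ts; rewrite !gt_max => /and3P[ps ps' ds] st.
have sd : t - s <= d by lra.
apply: (@approx_exists_small eps s t (eps / 4) (mxn A0 + mxn G0) A0 G0) => //; try lra.
- by move=> u Tu su ut; apply: hp => //; exact: lt_le_trans su.
- by move=> u Tu su ut; apply: hp' => //; exact: lt_le_trans su.
- by apply: le_trans hd; apply: ler_wpM2r => //; exact: addr_ge0.
- apply: le_trans hd'; rewrite lerD2l; apply: ler_wpM2r => //.
  by rewrite mulr_ge0 // ?addr_ge0 //; lra.
Qed.

Lemma approx_exists_itv eps a b : 0 < eps -> T a -> T b -> a <= b -> approx_exists eps a b.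
Proof.
move=> eps0; move: a b; apply: (ts_cousin Tcl).
- move=> a Ta x; have h : approx T A G eps (fun s => x) a a.
    split; last by move=> t; lra.
    exists 0 => // s t _ _ as_ st ta; rewrite subrr mxn0 mul0r; exact: lexx.
  by split; exists (fun=> x).
- move=> a b c Ta Tb Tc ab bc hab hbc x; split.
    have [[X hX Xa] _] := hab x; have [[X' hX' X'b] _] := hbc (X b).
    exists (fun s => if s <= b then X s else X' s); last by rewrite ab.
    exact: approx_cat.
  have [_ [X' hX' X'c]] := hbc x; have [_ [X hX Xb]] := hab (X' b).
  exists (fun s => if s <= b then X s else X' s); first exact: approx_cat.
  (* The test [s <= b] selects the first piece at [c] only in the degenerate case b = c. *)
  case: ifP => // cb; have bE : b = c by apply/eqP; rewrite eq_le bc.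
  by rewrite -bE Xb bE.
- by move=> t _ Tt _ _; exact: approx_exists_near_right.
- by move=> t; exact: approx_exists_near_left.
Qed.

End Euler.

(* The integral equation [F t - F s = int_s^t f] on [a, b], stated without an integral. *)
Definition mean_value (R : realType) (T : set R) (m n : nat)
    (f F : R -> 'M[R]_(m, n)) (a b : R) : Prop :=
  forall (s t : R) d (e : R), T s -> T t -> a <= s -> s <= t -> t <= b ->
    (forall r, T r -> s <= r -> r < t -> mxn (f r - d) <= e) ->
    mxn (F t - F s - (t - s) *: d) <= e * (t - s).

(** The integral form is used because it passes to uniform limits; [sol_rightlip] recovers the
    differential form. *)
Definition sol (R : realType) (T : set R) (n k : nat) (A : R -> 'M[R]_n)
    (G X : R -> 'M[R]_(n, k)) (a b : R) : Prop :=
  lip T X a b /\ mean_value T (fun t => A t *m X t + G t) X a b.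

(** * Exact solutions as uniform limits of polygons *)

Section MoreMeanValue.
Variables (R : realType) (T : set R).
Variables (m n : nat).
Implicit Types (a b c e s t r : R) (f F y : R -> 'M[R]_(m, n)).

Lemma le_lin_eps (x y e0 c : R) : 0 < e0 -> 0 <= c ->
  (forall e, 0 < e <= e0 -> x <= y + e * c) -> x <= y.
Proof.
move=> e00 c0 h; apply: le_eps => e e_gt0.
have [d d0 hd] := small_step c0 e_gt0.
have /h : 0 < Num.min d e0 <= e0 by rewrite lt_min d0 e00 ge_min lexx orbT.
move/le_trans; apply; rewrite lerD2l; apply: le_trans hd.
by apply: ler_wpM2r => //; rewrite ge_min lexx.
Qed.

Lemma rightlipN c y t : rightlip T c y t -> rightlip T c (fun s => - y s) t.
Proof.
move=> h e /h[r [Tr tr hr]]; exists r; split=> // s Ts ts sr.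
by rewrite -opprD mxnN; exact: hr.
Qed.

Lemma rightlipB c c' y y' t : rightlip T c y t -> rightlip T c' y' t ->
  rightlip T (c + c') (fun s => y s - y' s) t.
Proof. by move=> h /rightlipN h'; exact: rightlipD. Qed.

Lemma lipB y y' a b : lip T y a b -> lip T y' a b -> lip T (fun s => y s - y' s) a b.
Proof.
move=> [L L0 hL] [L' L'0 hL']; exists (L + L'); first exact: addr_ge0.
move=> s t Ts Tt as_ st tb.
have -> : y t - y' t - (y s - y' s) = (y t - y s) - (y' t - y' s).
  by apply/matrixP => i j; rewrite !mxE; ring.
rewrite mulrDl; apply: le_trans (mxnB _ _) _; apply: lerD; [exact: hL | exact: hL'].
Qed.

Lemma rightlip_ext c y y' t : (forall s, y s = y' s) -> rightlip T c y t -> rightlip T c y' t.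
Proof. by move=> /funext ->. Qed.

Lemma mean_value_sub f F a b a' b' : a <= a' -> b' <= b ->
  mean_value T f F a b -> mean_value T f F a' b'.
Proof.
move=> aa bb h s t d e Ts Tt as_ st tb hf; apply: h => //.
  exact: le_trans as_.
exact: le_trans bb.
Qed.

Lemma mean_value_congr f f' F F' a b :
  (forall t, T t -> a <= t -> t <= b -> f t = f' t /\ F t = F' t) ->
  mean_value T f F a b -> mean_value T f' F' a b.
Proof.
move=> hE h s t d e Ts Tt as_ st tb hf.
have at_ := le_trans as_ st; have sb := le_trans st tb.
rewrite -(hE t Tt at_ tb).2 -(hE s Ts as_ sb).2; apply: h => // r Tr sr rt.
have ar := le_trans as_ sr; have rb := le_trans (ltW rt) tb.
by rewrite (hE r Tr ar rb).1; exact: hf.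
Qed.

Lemma mean_value_cat f F a b c : T b -> mean_value T f F a b -> mean_value T f F b c ->
  mean_value T f F a c.
Proof.
move=> Tb h h' s t d e Ts Tt as_ st tc hf.
have [tb|bt] := leP t b; first exact: h.
have [bs|sb] := leP b s; first exact: h'.
have h1 : mxn (F b - F s - (b - s) *: d) <= e * (b - s).
  apply: h => //; first exact: ltW.
  by move=> r Tr sr rb; apply: hf => //; exact: lt_trans bt.
have h2 : mxn (F t - F b - (t - b) *: d) <= e * (t - b).
  apply: h' => //; first exact: ltW.
  by move=> r Tr br rt; apply: hf => //; exact: le_trans (ltW sb) br.
have -> : F t - F s - (t - s) *: d =
    (F b - F s - (b - s) *: d) + (F t - F b - (t - b) *: d).
  by apply/matrixP => i j; rewrite !mxE; ring.
apply: le_trans (mxnD _ _) _; lra.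
Qed.

End MoreMeanValue.

Section IntervalSolutions.
Variables (R : realType) (T : set R).
Hypotheses (Tcl : closed T) (Tub : unbounded_above T).
Variables (n k : nat) (A : R -> 'M[R]_n) (G : R -> 'M[R]_(n, k)).
Hypotheses (Ard : rdcont T A) (Grd : rdcont T G) (Areg : regressive T A).
Implicit Types (a b c e s t r eps d : R) (X : R -> 'M[R]_(n, k)).

(** The term [G] counts as an absolute perturbation: for eps <= 1, eps (1 + |X|) + |G| <= (1 + g) +
    eps |X|. *)
Lemma approx_bounded a b c x : T a -> T b -> a <= b -> T c -> a <= c -> c <= b ->
  exists B e0, [/\ 0 <= B, 0 < e0 & forall eps X, 0 < eps -> eps <= e0 ->
    approx T A G eps X a b -> X c = x ->
    forall t, T t -> a <= t -> t <= b -> mxn (X t) <= B].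
Proof.
move=> Ta Tb ab Tc ac cb.
have [K [e1 [K0 e10 hK]]] := stable_itv Tcl Tub k Ard Areg Ta Tb ab.
have [g g0 hg] := rdcont_bounded Tcl Tub Grd Ta Tb ab.
exists (K * (mxn x + (1 + g))), (Num.min 1 e1); split.
- by rewrite mulr_ge0 // !addr_ge0 ?mxn_ge0.
- by rewrite lt_min ltr01.
move=> eps X eps0; rewrite le_min => /andP[eps1 epse] [lX hX] <- t Tt at_ tb.
apply: (hK (1 + g) eps X) => //; [exact: addr_ge0 | exact: ltW |].
move=> u Tu au ub.
apply: (@rightlip_ext _ _ _ _ _
    (fun s => (X s - s *: (A u *m X u + G u)) + s *: G u)).
  by move=> s; apply/matrixP => i j; rewrite !mxE; ring.
apply: (rightlip_weaken _ (rightlipD (hX u Tu au ub) (rightlip_linear Tb ub))).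
have := hg u Tu au ub; lra.
Qed.

(** The forcing terms cancel in X - X', which solves the homogeneous equation with absolute error
    (eps + eps') (1 + B), vanishes at [c], and so is bounded by [stable_itv]. *)
Lemma approx_cauchy a b c x : T a -> T b -> a <= b -> T c -> a <= c -> c <= b ->
  exists D e0, [/\ 0 <= D, 0 < e0 & forall eps eps' X X',
    0 < eps <= e0 -> 0 < eps' <= e0 ->
    approx T A G eps X a b -> X c = x -> approx T A G eps' X' a b -> X' c = x ->
    forall t, T t -> a <= t -> t <= b -> mxn (X t - X' t) <= D * (eps + eps')].
Proof.
move=> Ta Tb ab Tc ac cb.
have [K [e1 [K0 e10 hK]]] := stable_itv Tcl Tub k Ard Areg Ta Tb ab.
have [B [e2 [B0 e20 hB]]] := approx_bounded x Ta Tb ab Tc ac cb.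
exists (K * (1 + B)), e2; split=> //; first by rewrite mulr_ge0 // addr_ge0.
move=> eps eps' X X' /andP[eps0 epse] /andP[eps0' epse'] aX Xc aX' Xc' t Tt at_ tb.
have [lX hX] := aX; have [lX' hX'] := aX'.
have eta0 : 0 <= (eps + eps') * (1 + B) by rewrite mulr_ge0 // addr_ge0 // ltW.
have -> : K * (1 + B) * (eps + eps') = K * (mxn (X c - X' c) + (eps + eps') * (1 + B)).
  by rewrite Xc Xc' subrr mxn0; ring.
apply: (hK _ 0 (fun s => X s - X' s)) => //; [exact: ltW | exact: lipB |].
move=> u Tu au ub.
apply: (@rightlip_ext _ _ _ _ _ (fun s => (X s - s *: (A u *m X u + G u)) -
    (X' s - s *: (A u *m X' u + G u)))).
  move=> s; rewrite mulmxBr; move: (A u *m X u) (A u *m X' u) => v v'.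
  by apply/matrixP => i j; rewrite !mxE; ring.
apply: (rightlip_weaken _ (rightlipB (hX u Tu au ub) (hX' u Tu au ub))).
have h1 := ler_wpM2l (ltW eps0) (hB eps X eps0 epse aX Xc u Tu au (ltW ub)).
have h2 := ler_wpM2l (ltW eps0') (hB eps' X' eps0' epse' aX' Xc' u Tu au (ltW ub)).
lra.
Qed.

Lemma sol_limit a b c x : T a -> T b -> a <= b -> T c -> a <= c -> c <= b ->
  (forall eps, 0 < eps -> exists2 X, approx T A G eps X a b & X c = x) ->
  exists2 X, sol T A G X a b & X c = x.
Proof.
move=> Ta Tb ab Tc ac cb hex.
have [B [e1 [B0 e10 hB]]] := approx_bounded x Ta Tb ab Tc ac cb.
have [D [e2 [D0 e20 hD]]] := approx_cauchy x Ta Tb ab Tc ac cb.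
have [al al0 hal] := rdcont_bounded Tcl Tub Ard Ta Tb ab.
have [g g0 hg] := rdcont_bounded Tcl Tub Grd Ta Tb ab.
have /choice[W hW] : forall eps, exists X, 0 < eps -> approx T A G eps X a b /\ X c = x.
  move=> eps; have [eps0|] := boolP (0 < eps); last by exists (fun=> 0).
  by have [X hX Xc] := hex eps eps0; exists X.
pose e0 := Num.min e1 e2; have e00 : 0 < e0 by rewrite lt_min e10.
have e01 e : e <= e0 -> e <= e1 by rewrite le_min => /andP[].
have e02 e : e <= e0 -> e <= e2 by rewrite le_min => /andP[].
pose E := (n * k)%:R * D; have E0 : 0 <= E by rewrite mulr_ge0.
have /choice[X hX] : forall t, exists l, T t -> a <= t -> t <= b ->
    forall e, 0 < e <= e0 -> mxn (W e t - l) <= e * E.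
  move=> t; have [[Tt at_ tb]|nt] := pselect [/\ T t, a <= t & t <= b]; last first.
    by exists 0 => Tt at_ tb; exfalso; apply: nt.
  have [|l hl] := @mxn_limit R n k (fun e => W e t) e0 D e00.
    move=> e e' /andP[h1 h2] /andP[h1' h2'].
    by apply: (hD e e') => //; rewrite ?h1 ?h1' ?e02 //; apply hW.
  by exists l => _ _ _ e he; apply: le_trans (hl e he) _; rewrite /E [leRHS]mulrC mulrA.
have WB e t : 0 < e <= e0 -> T t -> a <= t -> t <= b -> mxn (W e t) <= B.
  move=> /andP[h1 h2]; have [p q] := hW e h1; exact: hB (e01 _ h2) p q t.
have mv : mean_value T (fun t => A t *m X t + G t) X a b.
  move=> s t d e Ts Tt as_ st tb hf.
  have st0 : 0 <= t - s by lra.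
  (* Passing from [X] to [W eps] costs eps (1 + B) in the slope from the scheme, al eps E in the
     slope through [A], and eps E at each of the two end points. *)
  apply: (@le_lin_eps _ _ _ e0 ((1 + B + al * E) * (t - s) + E + E)) => //.
    by rewrite !addr_ge0 // mulr_ge0 // !addr_ge0 // mulr_ge0.
  move=> eps heps; have /andP[eps0 epse] := heps; have [[lW aW] Wc] := hW eps eps0.
  have h1 : mxn (W eps t - W eps s - (t - s) *: d) <=
      (eps * (1 + B) + (e + al * (eps * E))) * (t - s).
    have -> : W eps t - W eps s - (t - s) *: d = (W eps t - t *: d) - (W eps s - s *: d).
      by apply/matrixP => i j; rewrite !mxE; ring.
    apply: (mean_value_inequality (y := fun r => W eps r - r *: d) Tcl Ts Tt st).
      move=> r Tr sr rt; have ar := le_trans as_ sr; have rb := lt_le_trans rt tb.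
      pose fe := A r *m W eps r + G r.
      apply: (@rightlip_ext _ _ _ _ _ (fun s => (W eps s - s *: fe) + s *: (fe - d))).
        by move=> v; apply/matrixP => i j; rewrite !mxE; ring.
      apply: (rightlip_weaken _ (rightlipD (aW r Tr ar rb) (rightlip_linear Tb rb))).
      apply: lerD.
        by apply: ler_wpM2l; [exact: ltW | rewrite lerD2l WB // ltW].
      have -> : fe - d = (A r *m X r + G r - d) + A r *m (W eps r - X r).
        rewrite mulmxBr /fe; move: (A r *m X r) (A r *m W eps r) => v v'.
        by apply/matrixP => i j; rewrite !mxE; ring.
      apply: le_trans (mxnD _ _) _; apply: lerD; first exact: hf.
      by apply: mxnM_le; [exact: hal | apply: hX => //; exact: ltW].
    move=> r Tr sr rt.
    apply: (@lip_leftcont _ _ _ _ _ s t r) => //.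
    apply: lipB; first exact: lip_sub lW.
    exists (mxn d); first exact: mxn_ge0.
    by move=> u v Tu Tv su uv vt; rewrite -scalerBl mxnZ mulrC ger0_norm //; lra.
  have h2 := hX t Tt (le_trans as_ st) tb eps heps.
  have h3 := hX s Ts as_ (le_trans st tb) eps heps.
  have -> : X t - X s - (t - s) *: d =
     (W eps t - W eps s - (t - s) *: d) - ((W eps t - X t) - (W eps s - X s)).
    by apply/matrixP => i j; rewrite !mxE; ring.
  apply: le_trans (mxnB _ _) _.
  have := mxnB (W eps t - X t) (W eps s - X s).
  lra.
exists X.
  (* A bound for A X + G: [X] is within e0 E of [W e0], which is bounded by B. *)
  split=> //; exists (al * (B + e0 * E) + g).
    by rewrite addr_ge0 // mulr_ge0 // addr_ge0 // mulr_ge0 // ltW.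
  move=> s t Ts Tt as_ st tb; have := mv s t 0 (al * (B + e0 * E) + g) Ts Tt as_ st tb.
  rewrite scaler0 subr0; apply => r Tr sr rt; rewrite subr0.
  have ar := le_trans as_ sr; have rb := lt_le_trans rt tb.
  apply: le_trans (mxnD _ _) _; apply: lerD; last exact: hg.
  apply: mxnM_le; first exact: hal.
  have he0 : 0 < e0 <= e0 by rewrite e00 lexx.
  have := WB e0 r he0 Tr ar (ltW rb).
  have := hX r Tr ar (ltW rb) e0 he0.
  have := mxn_le_dist (X r) (W e0 r); rewrite mxnC; lra.
apply/esym/eqP; rewrite -subr_eq0; apply/eqP; apply: mxn_le0.
apply: (@le_lin_eps _ _ _ e0 E) => // e he; rewrite add0r.
have /andP[h _] := he; rewrite -(hW e h).2; exact: hX.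
Qed.

Lemma sol_exists a b x : T a -> T b -> a <= b ->
  (exists2 X, sol T A G X a b & X a = x) /\ (exists2 X, sol T A G X a b & X b = x).
Proof.
move=> Ta Tb ab; split; apply: sol_limit => // eps eps0.
  by have [] := approx_exists_itv Tcl Tub Ard Grd Areg eps0 Ta Tb ab x.
by have [] := approx_exists_itv Tcl Tub Ard Grd Areg eps0 Ta Tb ab x.
Qed.

(** On some [t, r) the field A X + G stays within e of its value at [t]: by right continuity at a
    right-dense point, and because [t] is the only point there before a jump. The integral equation
    is then applied with that value as [d]. *)
Lemma sol_rightlip X a b t : sol T A G X a b -> T b -> T t -> a <= t -> t < b ->
  rightlip T 0 (fun s => X s - s *: (A t *m X t + G t)) t.
Proof.
move=> [[L L0 lX] mv] Tb Tt at_ tb e e0.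
suff [r [Tr tr rb hr]] : exists r, [/\ T r, t < r, r <= b & forall u, T u -> t <= u -> u < r ->
    mxn (A u *m X u + G u - (A t *m X t + G t)) <= e].
  exists r; split=> // s Ts ts sr.
  have -> : X s - s *: (A t *m X t + G t) - (X t - t *: (A t *m X t + G t)) =
     X s - X t - (s - t) *: (A t *m X t + G t).
    move: (A t *m X t + G t) => v.
    by apply/matrixP => i j; rewrite !mxE; ring.
  apply: mv => //; [exact: ltW | exact: le_trans rb |] => u Tu tu us.
  by apply: hr => //; exact: lt_le_trans sr.
have [rd|tj] := right_cases Tub t; last first.
  exists (forward_jump T t); split=> //; [exact: forward_jump_mem | exact: forward_jump_le |].
  move=> u Tu tu uj; rewrite (@right_scattered_eq _ T t u _ Tu erefl) // subrr mxn0.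
  exact: ltW.
have NX := mxn_ge0 (X t); have NA := mxn_ge0 (A t).
have [e' e'0 he'] := @small_step R (mxn (X t) + 1) (e / 2) (addr_ge0 NX ler01) ltac:(lra).
have [d d0 hd] := @small_step R ((mxn (A t) + 1) * L) (e / 2)
  (mulr_ge0 (addr_ge0 NA ler01) L0) ltac:(lra).
have e1 : 0 < Num.min 1 e' by rewrite lt_min ltr01.
have [r1 [Tr1 tr1 hr1]] := rdcont_right Tcl Tub Ard Tt e1.
have [r2 [Tr2 tr2 hr2]] := rdcont_right Tcl Tub Grd Tt e1.
have [r3 [Tr3 tr3 hr3]] := right_dense_approx Tub rd d0.
exists (Num.min b (Num.min r1 (Num.min r2 r3))); split.
- by rewrite /Num.min; do 3! (case: ifP => // _).
- by rewrite !lt_min tb tr1 tr2.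
- by rewrite ge_min lexx.
move=> u Tu tu; rewrite !lt_min => /and4P[ub ur1 ur2 ur3].
have -> : A u *m X u + G u - (A t *m X t + G t) =
    A u *m (X u - X t) + (A u - A t) *m X t + (G u - G t).
  rewrite mulmxBr mulmxBl; move: (A u *m X u) (A u *m X t) (A t *m X t) => v1 v2 v3.
  by apply/matrixP => i j; rewrite !mxE; ring.
have := hr1 u Tu tu ur1; rewrite le_min => /andP[a1 a2].
have := hr2 u Tu tu ur2; rewrite le_min => /andP[_ a3].
have a4 : mxn (A u) <= mxn (A t) + 1.
  by have := mxn_le_dist (A u) (A t); lra.
have a5 : mxn (X u - X t) <= L * d.
  apply: le_trans (lX t u Tt Tu at_ tu (ltW ub)) _; apply: ler_wpM2l => //; lra.
have a6 := mxnM_le a4 a5.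
have a7 := mxnM_le a2 (lexx (mxn (X t))).
have a8 := mxnD (A u *m (X u - X t) + (A u - A t) *m X t) (G u - G t).
have a9 := mxnD (A u *m (X u - X t)) ((A u - A t) *m X t).
lra.
Qed.

(** The a priori bound with both errors zero, anchored at [c]; it works on both sides of [c], so
    agreement also propagates backwards. *)
Lemma sol_unique X X' a b c : sol T A G X a b -> sol T A G X' a b ->
  T a -> T b -> T c -> a <= c -> c <= b -> X c = X' c ->
  forall t, T t -> a <= t -> t <= b -> X t = X' t.
Proof.
move=> sX sX' Ta Tb Tc ac cb Xc t Tt at_ tb.
have [K [e0 [K0 e00 hK]]] := stable_itv Tcl Tub k Ard Areg Ta Tb (le_trans ac cb).
apply/eqP; rewrite -subr_eq0; apply/eqP; apply: mxn_le0.
have -> : (0 : R) = K * (mxn (X c - X' c) + 0) by rewrite Xc subrr mxn0 addr0 mulr0.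
apply: (hK 0 0 (fun s => X s - X' s)) => //; first exact: ltW.
  by apply: lipB; [exact: sX.1 | exact: sX'.1].
move=> u Tu au ub; rewrite mul0r.
apply: (@rightlip_ext _ _ _ _ _ (fun s => (X s - s *: (A u *m X u + G u)) -
    (X' s - s *: (A u *m X' u + G u)))).
  move=> s; rewrite mulmxBr; move: (A u *m X u) (A u *m X' u) => v v'.
  by apply/matrixP => i j; rewrite !mxE; ring.
exact: rightlipB (sol_rightlip sX Tb Tu au ub) (sol_rightlip sX' Tb Tu au ub).
Qed.

Lemma sol_sub X a b a' b' : a <= a' -> b' <= b -> sol T A G X a b -> sol T A G X a' b'.
Proof. by move=> aa bb [lX mX]; split; [exact: lip_sub lX | exact: mean_value_sub mX]. Qed.

Lemma sol_congr X X' a b : (forall t, T t -> a <= t -> t <= b -> X t = X' t) ->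
  sol T A G X a b -> sol T A G X' a b.
Proof.
move=> hE [lX mX]; split; first exact: lip_congr lX.
by apply: mean_value_congr mX => t Tt at_ tb; rewrite hE.
Qed.

(** [X t] is the value at [t] of some solution on the interval between [s] and [t]; uniqueness makes
    these choices restrictions of one another. *)
Lemma sol_global s x : T s ->
  exists2 X, (forall a b, T a -> T b -> a <= b -> sol T A G X a b) & X s = x.
Proof.
move=> Ts.
have /choice[X hX] : forall t, exists v : 'M[R]_(n, k), T t ->
    (s <= t -> exists2 Y, sol T A G Y s t & Y s = x /\ Y t = v) /\
    (t <= s -> exists2 Y, sol T A G Y t s & Y s = x /\ Y t = v).
  move=> t; have [Tt|nT] := pselect (T t); last by exists 0.
  have [st|ts] := ltP s t.
    have [[Y sY Ys] _] := sol_exists x Ts Tt (ltW st).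
    by exists (Y t) => _; split=> //; exists Y.
  have [_ [Y sY Ys]] := sol_exists x Tt Ts ts.
  exists (Y t) => _; split; last by exists Y.
  move=> st; have tE : t = s by apply/eqP; rewrite eq_le ts.
  by exists Y => //; move: sY; rewrite tE.
have right_sol b : T b -> s <= b -> sol T A G X s b.
  move=> Tb sb; have [Y sY [Ys _]] := (hX b Tb).1 sb.
  apply: sol_congr (sY) => t Tt st tb.
  have [Z sZ [Zs <-]] := (hX t Tt).1 st.
  apply: (@sol_unique Y Z s t s) => //; [|by rewrite Ys Zs].
  exact: sol_sub sY.
have left_sol a : T a -> a <= s -> sol T A G X a s.
  move=> Ta as_; have [Y sY [Ys _]] := (hX a Ta).2 as_.
  apply: sol_congr (sY) => t Tt at_ ts.
  have [Z sZ [Zs <-]] := (hX t Tt).2 ts.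
  apply: (@sol_unique Y Z t s s) => //; [|by rewrite Ys Zs].
  exact: sol_sub sY.
exists X; last first.
  by have [Z sZ [<- ->]] := (hX s Ts).1 (lexx s).
move=> a b Ta Tb ab; have [bs|/ltW sb] := leP b s.
  by apply: sol_sub (left_sol a Ta (le_trans ab bs)).
have [sa|/ltW as_] := leP s a.
  by apply: sol_sub (right_sol b Tb sb).
have [l1 m1] := left_sol a Ta as_; have [l2 m2] := right_sol b Tb sb.
by split; [exact: lip_cat l1 l2 | exact: mean_value_cat m1 m2].
Qed.

End IntervalSolutions.

(** * Continuity of matrix operations and closure of rd-continuity *)

Definition cont (R : realType) (T : set R) (m n : nat) (f : R -> 'M[R]_(m, n)) : Prop :=
  forall t, T t -> forall e : R, 0 < e ->
    exists2 d : R, 0 < d & forall s, T s -> `|s - t| < d -> mxn (f s - f t) <= e.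

Section Closeness.
Variable R : realType.
Implicit Types (m n p : nat) (e : R).

Lemma mulmx_close m n p (a0 : 'M[R]_(m, n)) (b0 : 'M[R]_(n, p)) e : 0 < e ->
  exists2 e', 0 < e' & forall a b, mxn (a - a0) <= e' -> mxn (b - b0) <= e' ->
    mxn (a *m b - a0 *m b0) <= e.
Proof.
move=> e0; have Na := mxn_ge0 a0; have Nb := mxn_ge0 b0.
have N0 : 0 <= mxn b0 + 1 + mxn a0 by lra.
have [d d0 hd] := small_step N0 e0.
exists (Num.min 1 d); first by rewrite lt_min ltr01.
move=> a b; rewrite !le_min => /andP[a1 ad] /andP[b1 bd].
have -> : a *m b - a0 *m b0 = (a - a0) *m b + a0 *m (b - b0).
  by rewrite mulmxBl mulmxBr addrA subrK.
have hb : mxn b <= mxn b0 + 1 by have := mxn_le_dist b b0; lra.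
have := mxnD ((a - a0) *m b) (a0 *m (b - b0)).
have := mxnM_le ad hb; have := mxnM_le (lexx (mxn a0)) bd; lra.
Qed.

(** From a^-1 - a0^-1 = a^-1 (a0 - a) a0^-1 with |a^-1| <= x + q, where x is the norm of the left
    side; for [a] near [a0] the term in x is absorbed as x / 2. *)
Lemma invmx_close n (a0 : 'M[R]_n) e : a0 \in unitmx -> 0 < e ->
  exists2 e', 0 < e' & forall a, a \in unitmx -> mxn (a - a0) <= e' ->
    mxn (invmx a - invmx a0) <= e.
Proof.
move=> ua0 e0; pose q := mxn (invmx a0); have q0 : 0 <= q by exact: mxn_ge0.
have [d d0 hd] := @small_step R q (1 / 2) q0 ltac:(lra).
have [d' d'0 hd'] := @small_step R (q * q) (e / 2) (mulr_ge0 q0 q0) ltac:(lra).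
exists (Num.min d d'); first by rewrite lt_min d0.
move=> a ua; rewrite le_min => /andP[ad ad'].
set x := mxn (invmx a - invmx a0); have x0 : 0 <= x by exact: mxn_ge0.
have Na := mxn_ge0 (a - a0).
have hx : x <= (x + q) * (mxn (a - a0) * q).
  have {1}-> : x = mxn (invmx a *m ((a0 - a) *m invmx a0)).
    by rewrite mulmxBl mulmxV // mulmxBr mulmx1 mulmxA mulVmx // mul1mx.
  apply: mxnM_le; first exact: mxn_le_dist.
  by apply: mxnM_le => //; rewrite mxnC.
have h1 : x * (mxn (a - a0) * q) <= x * (1 / 2).
  apply: ler_wpM2l => //; apply: le_trans hd; exact: ler_wpM2r.
have h2 : mxn (a - a0) * (q * q) <= e / 2.
  apply: le_trans hd'; apply: ler_wpM2r => //; exact: mulr_ge0.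
lra.
Qed.

End Closeness.

Section RdClosure.
Variables (R : realType) (T : set R).
Hypotheses (Tcl : closed T) (Tub : unbounded_above T).
Implicit Types (a b c e s t r d : R) (m n p : nat).

Lemma cont_rdcont m n (f : R -> 'M[R]_(m, n)) : cont T f -> rdcont T f.
Proof.
move=> hf; split=> t Tt _; first exact: hf.
exists (f t) => e e0; have [d d0 hd] := hf t Tt e e0.
exists (t - d); first lra.
by move=> s Ts ds st; apply: hd => //; rewrite ltr_norml; apply/andP; split; lra.
Qed.

Lemma rdcontM m n p (f : R -> 'M[R]_(m, n)) (g : R -> 'M[R]_(n, p)) :
  rdcont T f -> rdcont T g -> rdcont T (fun t => f t *m g t).
Proof.
move=> [f1 f2] [g1 g2]; split=> t Tt dt.
  move=> e e0; have [e' e'0 he'] := mulmx_close (f t) (g t) e0.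
  have [d d0 hd] := f1 t Tt dt e' e'0; have [d' d'0 hd'] := g1 t Tt dt e' e'0.
  exists (Num.min d d'); first by rewrite lt_min d0.
  by move=> s Ts; rewrite lt_min => /andP[sd sd']; apply: he'; [exact: hd | exact: hd'].
have [L hL] := f2 t Tt dt; have [L' hL'] := g2 t Tt dt.
exists (L *m L') => e e0; have [e' e'0 he'] := mulmx_close L L' e0.
have [d d0 hd] := hL e' e'0; have [d' d'0 hd'] := hL' e' e'0.
exists (Num.max d d'); first by rewrite gt_max d0.
by move=> s Ts; rewrite gt_max => /andP[sd sd'] st; apply: he'; [exact: hd | exact: hd'].
Qed.

Lemma rdcontD m n (f g : R -> 'M[R]_(m, n)) :
  rdcont T f -> rdcont T g -> rdcont T (fun t => f t + g t).
Proof.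
move=> [f1 f2] [g1 g2]; split=> t Tt dt.
  move=> e e0; have e2 : 0 < e / 2 by lra.
  have [d d0 hd] := f1 t Tt dt _ e2; have [d' d'0 hd'] := g1 t Tt dt _ e2.
  exists (Num.min d d'); first by rewrite lt_min d0.
  move=> s Ts; rewrite lt_min => /andP[sd sd']; rewrite opprD addrACA.
  apply: le_trans (mxnD _ _) _.
  by have := hd s Ts sd; have := hd' s Ts sd'; lra.
have [L hL] := f2 t Tt dt; have [L' hL'] := g2 t Tt dt.
exists (L + L') => e e0; have e2 : 0 < e / 2 by lra.
have [d d0 hd] := hL _ e2; have [d' d'0 hd'] := hL' _ e2.
exists (Num.max d d'); first by rewrite gt_max d0.
move=> s Ts; rewrite gt_max => /andP[sd sd'] st; rewrite opprD addrACA.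
apply: le_trans (mxnD _ _) _.
by have := hd s Ts sd st; have := hd' s Ts sd' st; lra.
Qed.

Lemma rdcont_tr m n (f : R -> 'M[R]_(m, n)) : rdcont T f -> rdcont T (fun t => (f t)^T).
Proof.
move=> [f1 f2]; split=> t Tt dt.
  move=> e e0; have [d d0 hd] := f1 t Tt dt e e0; exists d => // s Ts sd.
  by rewrite -raddfB mxn_tr; exact: hd.
have [L hL] := f2 t Tt dt; exists L^T => e e0.
have [d d0 hd] := hL e e0; exists d => // s Ts sd st.
by rewrite -raddfB mxn_tr; exact: hd.
Qed.

Lemma rdcont_cst m n (v : 'M[R]_(m, n)) : rdcont T (fun=> v).
Proof.
by apply: cont_rdcont => t _ e e0; exists 1 => // s _ _; rewrite subrr mxn0 ltW.
Qed.

Lemma cont_inv n (f : R -> 'M[R]_n) : cont T f -> (forall t, T t -> f t \in unitmx) ->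
  cont T (fun t => invmx (f t)).
Proof.
move=> hf fu t Tt e e0; have [e' e'0 he'] := invmx_close (fu t Tt) e0.
have [d d0 hd] := hf t Tt e' e'0; exists d => // s Ts sd.
by apply: he'; [exact: fu | exact: hd].
Qed.

(** Sigma may be discontinuous, but sigma(s) lies in (s, t] or is [s] itself for s < t, so the left
    limit is f(t). At a right-dense [t], a point r of [T] just above [t] bounds sigma(s) for all s <
    r. *)
Lemma rdcont_forward_jump m n (f : R -> 'M[R]_(m, n)) : cont T f ->
  rdcont T (fun t => f (forward_jump T t)).
Proof.
move=> hf; split=> t Tt dt.
  move=> e e0; have [d d0 hd] := hf t Tt e e0.
  have [r [Tr tr rd]] := right_dense_approx Tub dt d0.
  have tE := dt.2; rewrite tE; exists (Num.min d (r - t)).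
    by rewrite lt_min d0; lra.
  move=> s Ts; rewrite lt_min !ltr_norml => /andP[/andP[h1 h2] /andP[h3 h4]].
  have sj := forward_jump_ge Tub s.
  apply: hd; first exact: forward_jump_mem.
  rewrite ltr_norml; apply/andP.
  have [st|ts] := ltP s t.
    by have := forward_jump_le Tt st; split; lra.
  have sr : s < r by lra.
  by have := forward_jump_le Tr sr; split; lra.
exists (f t) => e e0; have [d d0 hd] := hf t Tt e e0.
exists (t - d); first lra.
move=> s Ts ds st; apply: hd; first exact: forward_jump_mem.
have := forward_jump_ge Tub s; have := forward_jump_le Tt st.
by move=> h1 h2; rewrite ltr_norml; apply/andP; split; lra.
Qed.

End RdClosure.

(** * Calculus of the delta derivative *)

Section DeltaDerivative.
Variables (R : realType) (T : set R).
Hypotheses (Tcl : closed T) (Tub : unbounded_above T).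
Implicit Types (a b c e s t r d : R) (m n p : nat).

(** The definition of the derivative tested at s = t, with arbitrary e. *)
Lemma hasdelta_jump m n (F : R -> 'M[R]_(m, n)) t D : T t -> hasdelta T F t D ->
  F (forward_jump T t) - F t - (forward_jump T t - t) *: D = 0.
Proof.
move=> Tt h; apply: mxn_le0.
set mu := forward_jump T t - t.
have mu0 : 0 <= mu by rewrite subr_ge0; exact: forward_jump_ge.
apply: (@le_lin_eps _ _ _ 1 mu) => // e /andP[e0 _]; rewrite add0r.
have [d d0 hd] := h e e0; have := hd t Tt; rewrite subrr normr0 => /(_ d0).
by rewrite (ger0_norm mu0).
Qed.

Lemma hasdelta_cont m n (F f : R -> 'M[R]_(m, n)) :
  (forall t, T t -> hasdelta T F t (f t)) -> cont T F.
Proof.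
move=> h t Tt e e0; set D := f t; set u := forward_jump T t.
have mu0 : 0 <= u - t by rewrite subr_ge0; exact: forward_jump_ge.
have [e' e'0 he'] := @small_step R (u - t + 1) (e / 2) (addr_ge0 mu0 ler01) ltac:(lra).
have [d d0 hd] := h t Tt e' e'0.
have [d' d'0 hd'] := @small_step R (mxn D) (e / 2) (mxn_ge0 D) ltac:(lra).
exists (Num.min 1 (Num.min d d')); first by rewrite !lt_min ltr01 d0.
move=> s Ts; rewrite !lt_min => /and3P[s1 sd sd'].
have -> : F s - F t = (F u - F t - (u - t) *: D) - (F u - F s - (u - s) *: D) + (s - t) *: D.
  by apply/matrixP => i j; rewrite !mxE; ring.
rewrite hasdelta_jump //; last exact: h.
rewrite sub0r; apply: le_trans (mxnD _ _) _; rewrite mxnN mxnZ.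
have h1 := hd s Ts sd.
have h2 : `|u - s| <= u - t + 1.
  have -> : u - s = (u - t) - (s - t) by ring.
  by apply: le_trans (ler_normB _ _) _; rewrite (ger0_norm mu0) lerD2l ltW.
have h3 : e' * `|u - s| <= e' * (u - t + 1) by apply: ler_wpM2l => //; exact: ltW.
have h4 : `|s - t| * mxn D <= d' * mxn D by apply: ler_wpM2r; [exact: mxn_ge0 | exact: ltW].
rewrite -/u -/D in h1.
lra.
Qed.

Lemma cont_leftcont m n (F : R -> 'M[R]_(m, n)) t : T t -> cont T F -> leftcont T F t.
Proof.
move=> Tt hF e e0; have [d d0 hd] := hF t Tt e e0; exists (t - d); first lra.
by move=> s Ts ds st; apply: hd => //; rewrite ltr_norml; apply/andP; split; lra.
Qed.

Lemma hasdelta_rightlip m n (F : R -> 'M[R]_(m, n)) t D : T t -> hasdelta T F t D ->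
  rightlip T 0 (fun s => F s - s *: D) t.
Proof.
move=> Tt h e e0; have [rd|tj] := right_cases Tub t; last first.
  exists (forward_jump T t); split=> //; first exact: forward_jump_mem.
  move=> s Ts ts sj; have -> : s = forward_jump T t.
    by apply/eqP; rewrite eq_le sj forward_jump_le.
  set u := forward_jump T t.
  have -> : F u - u *: D - (F t - t *: D) = F u - F t - (u - t) *: D.
    by apply/matrixP => i j; rewrite !mxE; ring.
  by rewrite hasdelta_jump // mxn0 mulr_ge0 ?ltW // subr_gt0.
have [d d0 hd] := h e e0; have [r [Tr tr rlt]] := right_dense_approx Tub rd d0.
exists r; split=> // s Ts ts sr.
have st : `|s - t| < d by rewrite ger0_norm; lra.
have := hd s Ts st; rewrite rd.2 distrC ger0_norm; last by lra.
rewrite -mxnN.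
have -> // : - (F t - F s - (t - s) *: D) = F s - s *: D - (F t - t *: D).
by apply/matrixP => i j; rewrite !mxE; ring.
Qed.

Lemma hasdelta_mean_value m n (f F : R -> 'M[R]_(m, n)) a b :
  (forall t, T t -> hasdelta T F t (f t)) -> mean_value T f F a b.
Proof.
move=> h s t d e Ts Tt as_ st tb hf.
have -> : F t - F s - (t - s) *: d = (F t - t *: d) - (F s - s *: d).
  by apply/matrixP => i j; rewrite !mxE; ring.
apply: (mean_value_inequality (y := fun r => F r - r *: d) Tcl Ts Tt st).
  move=> r Tr sr rt.
  apply: (@rightlip_ext _ _ _ _ _ (fun s => (F s - s *: f r) + s *: (f r - d))).
    by move=> v; apply/matrixP => i j; rewrite !mxE; ring.
  apply: (rightlip_weaken _ (rightlipD (hasdelta_rightlip Tr (h r Tr)) (rightlip_linear Tt rt))).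
  by rewrite add0r; exact: hf.
move=> r Tr sr rt; apply: cont_leftcont => //.
move: (hasdelta_cont h) => hF u Tu e' e'0; have e2 : 0 < e' / 2 by lra.
have [d1 d10 hd1] := hF u Tu _ e2.
have [d2 d20 hd2] := small_step (mxn_ge0 d) e2.
exists (Num.min d1 d2); first by rewrite lt_min d10.
move=> v Tv; rewrite lt_min => /andP[v1 v2].
have -> : F v - v *: d - (F u - u *: d) = (F v - F u) - (v - u) *: d.
  by apply/matrixP => i j; rewrite !mxE; ring.
apply: le_trans (mxnB _ _) _; rewrite mxnZ.
have := hd1 v Tv v1.
have : `|v - u| * mxn d <= d2 * mxn d by apply: ler_wpM2r; [exact: mxn_ge0 | exact: ltW].
lra.
Qed.

Lemma hasdelta_lip m n (f F : R -> 'M[R]_(m, n)) a b : rdcont T f -> T a -> T b -> a <= b ->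
  (forall t, T t -> hasdelta T F t (f t)) -> lip T F a b.
Proof.
move=> fr Ta Tb ab h; have [K K0 hK] := rdcont_bounded Tcl Tub fr Ta Tb ab.
exists K => // s t Ts Tt as_ st tb.
have := hasdelta_mean_value h (a := a) (b := b) (d := 0) (e := K) Ts Tt as_ st tb.
rewrite scaler0 subr0; apply => r Tr sr rt; rewrite subr0; apply: hK => //.
  exact: le_trans sr.
exact: lt_le_trans tb.
Qed.

(** Lipschitz bounds live on intervals with ends in [T]; this supplies one around [t], with p = t at
    a minimum of [T]. *)
Lemma ts_neighborhood t : T t -> exists p q d : R, [/\ T p, T q, 0 < d &
  forall s, T s -> `|s - t| < d -> [/\ p <= s, s <= q, p <= t & t <= q]].
Proof.
move=> Tt; have [q [Tq tq]] := forward_set_nonempty Tub t.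
have [[p [Tp pt]]|np] := pselect (exists p : R, T p /\ p < t).
  exists p, q, (Num.min (t - p) (q - t)); split=> //.
    by rewrite lt_min !subr_gt0 pt.
  move=> s Ts; rewrite lt_min !ltr_norml => /andP[/andP[h1 h2] /andP[h3 h4]].
  by split; lra.
exists t, q, (q - t); split=> //; first by rewrite subr_gt0.
move=> s Ts; rewrite ltr_norml => /andP[h1 h2]; split; try lra.
by rewrite leNgt; apply/negP => st; apply: np; exists s.
Qed.

Lemma lip_cont m n (F : R -> 'M[R]_(m, n)) :
  (forall a b, T a -> T b -> a <= b -> lip T F a b) -> cont T F.
Proof.
move=> hl t Tt e e0; have [p [q [d [Tp Tq d0 hd]]]] := ts_neighborhood Tt.
have [p1 q1 p2 q2] := hd t Tt ltac:(by rewrite subrr normr0).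
have [L L0 hL] := hl p q Tp Tq (le_trans p1 q1).
have [d' d'0 hd'] := small_step L0 e0.
exists (Num.min d d'); first by rewrite lt_min d0.
move=> s Ts; rewrite lt_min => /andP[/(hd s Ts)[ps sq _ _] sd'].
have : L * `|s - t| <= e.
  by apply: le_trans hd'; rewrite mulrC; apply: ler_wpM2r => //; exact: ltW.
apply: le_trans; have [st|/ltW ts] := leP s t.
  rewrite mxnC distrC (ger0_norm (x := t - s)) ?subr_ge0 //; exact: hL.
rewrite (ger0_norm (x := s - t)) ?subr_ge0 //; exact: hL.
Qed.

(** At a right-dense point [f] is continuous, and the integral equation applies on both sides. At a
    right-scattered point the increment over the jump is exact; continuity of [F] gives an error of
    at most e mu / 2 for nearby s, while |sigma(t) - s| >= mu / 2. *)
Lemma mean_value_hasdelta m n (f F : R -> 'M[R]_(m, n)) : rdcont T f -> cont T F ->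
  (forall a b, T a -> T b -> a <= b -> mean_value T f F a b) ->
  forall t, T t -> hasdelta T F t (f t).
Proof.
move=> [fr _] Fc mv t Tt e e0; have [rd|tj] := right_cases Tub t.
  have [d d0 hd] := fr t Tt rd e e0; exists d => // s Ts st.
  rewrite rd.2; move: st; rewrite ltr_norml => /andP[h1 h2].
  have [ts|/ltW ts] := leP t s.
    rewrite distrC ger0_norm ?subr_ge0 // -mxnN.
    have -> : - (F t - F s - (t - s) *: f t) = F s - F t - (s - t) *: f t.
      by apply/matrixP => i j; rewrite !mxE; ring.
    apply: (mv t s Tt Ts ts) => // r Tr tr rs.
    by apply: hd => //; rewrite ltr_norml; apply/andP; split; lra.
  rewrite ger0_norm ?subr_ge0 //.
  apply: (mv s t Ts Tt ts) => // r Tr sr rt.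
  by apply: hd => //; rewrite ltr_norml; apply/andP; split; lra.
set u := forward_jump T t; have Tu : T u by exact: forward_jump_mem.
pose mu := u - t; have mu0 : 0 < mu by rewrite subr_gt0.
have jump : F u - F t - (u - t) *: f t = 0.
  apply: mxn_le0; rewrite -(mul0r (u - t)).
  apply: (mv t u Tt Tu (ltW tj)) => //; first exact: ltW.
  by move=> r Tr tr ru; rewrite (@right_scattered_eq _ T t r u) // subrr mxn0.
have e4 : 0 < e * mu / 4 by rewrite divr_gt0 // mulr_gt0.
have [d d0 hd] := Fc t Tt _ e4.
have [d' d'0 hd'] := small_step (mxn_ge0 (f t)) e4.
exists (Num.min (mu / 2) (Num.min d d')); first by rewrite !lt_min d0 d'0 andbT divr_gt0.
move=> s Ts; rewrite !lt_min => /and3P[s1 sd sd'].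
have -> : F u - F s - (u - s) *: f t =
    (F u - F t - (u - t) *: f t) - (F s - F t) + (s - t) *: f t.
  by apply/matrixP => i j; rewrite !mxE; ring.
rewrite jump sub0r; apply: le_trans (mxnD _ _) _; rewrite mxnN mxnZ.
have h1 := hd s Ts sd.
have h2 : `|s - t| * mxn (f t) <= d' * mxn (f t).
  by apply: ler_wpM2r; [exact: mxn_ge0 | exact: ltW].
have h3 : mu / 2 <= `|u - s|.
  apply: le_trans (ler_norm _); move: s1; rewrite ltr_norml => /andP[_]; rewrite /mu; lra.
have := ler_wpM2l (ltW e0) h3; lra.
Qed.

(** Of the two product rules, the one evaluating the left factor at sigma: with F = X it yields the
    X(sigma) to be cancelled. Continuity of [H] bounds H s and makes (u - s) D (H s - H t)
    negligible. *)
Lemma hasdeltaM m n p (F : R -> 'M[R]_(m, n)) (H : R -> 'M[R]_(n, p)) t D D' :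
  T t -> cont T H -> hasdelta T F t D -> hasdelta T H t D' ->
  hasdelta T (fun s => F s *m H s) t (D *m H t + F (forward_jump T t) *m D').
Proof.
move=> Tt Hc hF hH e e0; set u := forward_jump T t.
have N1 := mxn_ge0 (H t); have N2 := mxn_ge0 D; have N3 := mxn_ge0 (F u).
have N0 : 0 <= mxn (H t) + 1 + mxn D + mxn (F u) by lra.
have [k k0 hk] := small_step N0 e0.
have k1 : 0 < Num.min 1 k by rewrite lt_min ltr01.
have [d1 d10 hd1] := hF _ k0; have [d2 d20 hd2] := hH _ k0.
have [d3 d30 hd3] := Hc t Tt _ k1.
exists (Num.min d1 (Num.min d2 d3)); first by rewrite !lt_min d10 d20.
move=> s Ts; rewrite !lt_min => /and3P[s1 s2 s3].
have := hd3 s Ts s3; rewrite le_min => /andP[g1 g2].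
have h1 := hd1 s Ts s1; have h2 := hd2 s Ts s2; rewrite -/u in h1 h2.
set a := `|u - s| in h1 h2 *; have a0 : 0 <= a by exact: normr_ge0.
have -> : F u *m H u - F s *m H s - (u - s) *: (D *m H t + F u *m D') =
   (F u - F s - (u - s) *: D) *m H s + ((u - s) *: D) *m (H s - H t) +
   F u *m (H u - H s - (u - s) *: D').
  rewrite !mulmxBl !mulmxBr -!scalemxAl -!scalemxAr.
  move: (F u *m H u) (F s *m H s) (D *m H t) (F u *m D') (F u *m H s) (D *m H s).
  move=> v1 v2 v3 v4 v5 v6.
  by apply/matrixP => i j; rewrite !mxE; ring.
have g3 : mxn (H s) <= mxn (H t) + 1 by have := mxn_le_dist (H s) (H t); lra.
have b1 := mxnM_le h1 g3.
have b2 := mxnM_le (lexx (mxn ((u - s) *: D))) g2.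
rewrite [in X in _ <= X]mxnZ -/a in b2.
have b3 := mxnM_le (lexx (mxn (F u))) h2.
apply: le_trans (mxnD _ _) _.
have := mxnD ((F u - F s - (u - s) *: D) *m H s) (((u - s) *: D) *m (H s - H t)).
have := ler_wpM2r a0 hk.
lra.
Qed.

Lemma hasdelta_cst m n (v : 'M[R]_(m, n)) t : hasdelta T (fun=> v) t 0.
Proof.
move=> e e0; exists 1 => // s _ _; rewrite subrr scaler0 subr0 mxn0.
by rewrite mulr_ge0 // ltW.
Qed.

Lemma hasdeltaD m n (F H : R -> 'M[R]_(m, n)) t D D' :
  hasdelta T F t D -> hasdelta T H t D' -> hasdelta T (fun s => F s + H s) t (D + D').
Proof.
move=> hF hH e e0; have e2 : 0 < e / 2 by lra.
have [d1 d10 hd1] := hF _ e2; have [d2 d20 hd2] := hH _ e2.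
exists (Num.min d1 d2); first by rewrite lt_min d10.
move=> s Ts; rewrite lt_min => /andP[s1 s2].
have := hd1 s Ts s1; have := hd2 s Ts s2.
set u := forward_jump T t.
have -> : F u + H u - (F s + H s) - (u - s) *: (D + D') =
  (F u - F s - (u - s) *: D) + (H u - H s - (u - s) *: D').
  by apply/matrixP => i j; rewrite !mxE; ring.
move=> h1 h2; apply: le_trans (mxnD _ _) _; lra.
Qed.

Lemma hasdeltaN m n (F : R -> 'M[R]_(m, n)) t D :
  hasdelta T F t D -> hasdelta T (fun s => - F s) t (- D).
Proof.
move=> hF e e0; have [d d0 hd] := hF _ e0; exists d => // s Ts sd.
set u := forward_jump T t.
have -> : - F u - - F s - (u - s) *: - D = - (F u - F s - (u - s) *: D).
  by apply/matrixP => i j; rewrite !mxE; ring.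
by rewrite mxnN; exact: hd.
Qed.

Lemma hasdelta_zero_const m n (F : R -> 'M[R]_(m, n)) (f : R -> 'M[R]_(m, n)) a b :
  (forall t, T t -> hasdelta T F t (f t)) -> T a -> T b -> a <= b ->
  (forall t, T t -> a <= t -> t < b -> f t = 0) -> F b = F a.
Proof.
move=> hF Ta Tb ab f0; apply/eqP; rewrite -subr_eq0; apply/eqP; apply: mxn_le0.
have := hasdelta_mean_value hF (a := a) (b := b) (d := 0) (e := 0) Ta Tb (lexx _) ab (lexx _).
rewrite scaler0 subr0 mul0r; apply => r Tr ar rb.
by rewrite f0 // subr0 mxn0.
Qed.

End DeltaDerivative.

(** * Linear equations, antiderivatives and the delta integral *)

Section LinearEquation.
Variables (R : realType) (T : set R).
Hypotheses (Tcl : closed T) (Tub : unbounded_above T).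
Implicit Types (a b c e s t r d : R) (m n k : nat).

Lemma linear_exists n k (A : R -> 'M[R]_n) (G : R -> 'M[R]_(n, k)) s x :
  rdcont T A -> rdcont T G -> regressive T A -> T s ->
  exists2 X, (forall t, T t -> hasdelta T X t (A t *m X t + G t)) & X s = x.
Proof.
move=> Ard Grd Areg Ts.
have [X hX Xs] := sol_global Tcl Tub Ard Grd Areg x Ts.
have Xc : cont T X.
  by apply: (lip_cont Tub) => a b Ta Tb ab; exact: (hX a b Ta Tb ab).1.
exists X => //; apply: (mean_value_hasdelta Tcl Tub) => //.
  by apply: rdcontD => //; apply: rdcontM => //; exact: cont_rdcont.
by move=> a b Ta Tb ab; exact: (hX a b Ta Tb ab).2.
Qed.

Lemma linear_unique n k (A : R -> 'M[R]_n) (G : R -> 'M[R]_(n, k)) X X' s :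
  rdcont T A -> rdcont T G -> regressive T A -> T s ->
  (forall t, T t -> hasdelta T X t (A t *m X t + G t)) ->
  (forall t, T t -> hasdelta T X' t (A t *m X' t + G t)) ->
  X s = X' s -> forall t, T t -> X t = X' t.
Proof.
move=> Ard Grd Areg Ts hX hX' Xs t Tt.
have is_sol Y a b : T a -> T b -> a <= b ->
    (forall t, T t -> hasdelta T Y t (A t *m Y t + G t)) -> sol T A G Y a b.
  move=> Ta Tb ab hY; split; last exact: (hasdelta_mean_value Tcl Tub).
  apply: (hasdelta_lip Tcl Tub _ Ta Tb ab hY); apply: rdcontD => //; apply: rdcontM => //.
  by apply: cont_rdcont; exact: (hasdelta_cont Tub hY).
have [st|/ltW ts] := leP s t.
  exact: (sol_unique Tcl Tub Ard Grd Areg (is_sol X s t Ts Tt st hX)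
           (is_sol X' s t Ts Tt st hX') Ts Tt Ts).
exact: (sol_unique Tcl Tub Ard Grd Areg (is_sol X t s Tt Ts ts hX)
         (is_sol X' t s Tt Ts ts hX') Tt Ts Ts).
Qed.

Lemma regressive0 n : regressive T (fun=> 0 : 'M[R]_n).
Proof. by move=> t _; rewrite scaler0 addr0 unitmx1. Qed.

Lemma antiderivative_exists m n (f : R -> 'M[R]_(m, n)) s x : rdcont T f -> T s ->
  exists2 F, (forall t, T t -> hasdelta T F t (f t)) & F s = x.
Proof.
move=> fr Ts.
have [F hF Fs] := linear_exists x (rdcont_cst T (0 : 'M[R]_m)) fr (@regressive0 m) Ts.
by exists F => // t Tt; have := hF t Tt; rewrite mul0mx add0r.
Qed.

(** The entries of [F] show that the default of [xget] is not taken; the antiderivative it picks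
    differs from that entry by a function of zero derivative. *)
Lemma mx_delta_integralE m n (f F : R -> 'M[R]_(m, n)) a b :
  (forall t, T t -> hasdelta T F t (f t)) -> T a -> T b -> a <= b ->
  mx_delta_integral T f a b = F b - F a.
Proof.
move=> hF Ta Tb ab; apply/matrixP => i j; rewrite !mxE /delta_integral.
case: xgetP => [H _ hH|]; last first.
  move/(_ (fun t => F t i j)); case => t Tt; exact: (hasdeltaP _ _ _ _).2 (hF t Tt) i j.
(* Scalar functions become 1 by 1 matrices, to which the [hasdelta] calculus applies. *)
pose P (g : R -> R) := fun t => (g t)%:M : 'M[R]_1.
have toP (g g' : R -> R) : (forall t, T t -> is_delta_derive T g t (g' t)) ->
    forall t, T t -> hasdelta T (P g) t (P g' t).
  move=> h t Tt; apply/hasdeltaP => p q; rewrite !ord1 /P mxE eqxx mulr1n.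
  by under eq_fun do rewrite mxE eqxx mulr1n; exact: h.
have h1 := toP _ _ hH.
have h2 := toP (fun t => F t i j) (fun t => f t i j)
  (fun t Tt => (hasdeltaP _ _ _ _).2 (hF t Tt) i j).
have h3 t (Tt : T t) := hasdeltaD (h1 t Tt) (hasdeltaN (h2 t Tt)).
have /matrixP/(_ 0 0) := hasdelta_zero_const Tcl Tub h3 Ta Tb ab (fun t _ _ _ => subrr _).
rewrite !mxE eqxx !mulr1n; lra.
Qed.

Lemma mxn_scalar (x : 'M[R]_1) : mxn x = `|x 0 0|.
Proof. by rewrite /mxn !big_ord1. Qed.

(** [F] is monotone with equal end values, hence constant on [a, b]. The right quotient of F - s
    f(t) at [t] then has norm |f t|, and it is arbitrarily small, be [t] right-dense or
    right-scattered. *)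
Lemma nonneg_derivative_vanishes (f F : R -> 'M[R]_1) a b : rdcont T f ->
  (forall t, T t -> hasdelta T F t (f t)) -> (forall t, T t -> 0 <= f t 0 0) ->
  T a -> T b -> F b = F a -> forall t, T t -> a <= t -> t < b -> f t = 0.
Proof.
move=> fr hF f0 Ta Tb Fab t Tt at_ tb.
have ab : a <= b by exact: le_trans (ltW tb).
have [K K0 hK] := rdcont_bounded Tcl Tub fr Ta Tb ab.
have mono s u : T s -> T u -> a <= s -> s <= u -> u <= b -> F s 0 0 <= F u 0 0.
  move=> Ts Tu as_ su ub.
  (* [0 <= f <= K] reads [|f - K / 2| <= K / 2]. *)
  have := hasdelta_mean_value Tcl Tub hF (a := a) (b := b)
    (d := (K / 2)%:M) (e := K / 2) Ts Tu as_ su ub.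
  rewrite mxn_scalar !mxE eqxx !mulr1n => h.
  have /h : forall r, T r -> s <= r -> r < u -> mxn (f r - (K / 2)%:M) <= K / 2.
    move=> r Tr sr ru; rewrite mxn_scalar !mxE eqxx mulr1n.
    have := hK r Tr (le_trans as_ sr) (lt_le_trans ru ub).
    have := f0 r Tr; rewrite mxn_scalar !ler_norml => h1 /andP[_ h2].
    by apply/andP; split; lra.
  rewrite ler_norml => /andP[h1 _]; lra.
have Fa u : T u -> a <= u -> u <= b -> F u = F a.
  move=> Tu au ub; apply/matrixP => i j; rewrite !ord1; apply/eqP; rewrite eq_le.
  by rewrite -{1}Fab !mono.
apply: mxn_le0; apply: le_eps => e e0; rewrite add0r.
have [r [Tr tr hr]] := hasdelta_rightlip Tcl Tub Tt (hF t Tt) e0.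
pose s := Num.min r b.
have Ts : T s by rewrite /s /Num.min; case: ifP.
have ts : t < s by rewrite lt_min tr.
have := hr s Ts ts; rewrite ge_min lexx => /(_ isT).
rewrite (Fa t Tt at_ (ltW tb)) (Fa s Ts) ?ge_min ?lexx ?orbT //; last exact: le_trans (ltW ts).
have -> : F a - s *: f t - (F a - t *: f t) = (t - s) *: f t.
  by apply/matrixP => i j; rewrite !mxE; ring.
rewrite mxnZ distrC ger0_norm ?subr_ge0 ?(ltW ts) // mulrC.
by rewrite ler_pM2r // subr_gt0.
Qed.

Lemma row_mul_tr_ge0 m (w : 'rV[R]_m) : 0 <= (w *m w^T) 0 0.
Proof. by rewrite mxE; apply: sumr_ge0 => i _; rewrite mxE -expr2 sqr_ge0. Qed.

Lemma row_mul_tr_eq0 m (w : 'rV[R]_m) : w *m w^T = 0 -> w = 0.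
Proof.
move=> /matrixP/(_ 0 0); rewrite !mxE => /eqP; rewrite psumr_eq0; last first.
  by move=> i _; rewrite mxE -expr2 sqr_ge0.
move=> /allP h; apply/matrixP => i j; rewrite ord1 mxE.
by have := h j (mem_index_enum _); rewrite mxE -expr2 sqrf_eq0 => /eqP.
Qed.

Lemma singular_left_kernel n (M : 'M[R]_n) : M \notin unitmx ->
  exists2 v : 'rV[R]_n, v != 0 & v *m M = 0.
Proof.
rewrite -row_free_unit -kermx_eq0 => /rowV0Pn[v /sub_kermxP vM v0].
by exists v.
Qed.

End LinearEquation.

(** * The transition matrix and variation of constants *)

Section Transition.
Variables (R : realType) (T : set R).
Hypotheses (Tcl : closed T) (Tub : unbounded_above T).
Variables (n : nat) (A : R -> 'M[R]_n).
Hypotheses (Ard : rdcont T A) (Areg : regressive T A).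
Variables (t0 : R) (X : R -> 'M[R]_n).
Hypotheses (Tt0 : T t0) (XE : forall t, T t -> hasdelta T X t (A t *m X t)) (X0 : X t0 = 1%:M).

Lemma homogeneous_unique k (Z Z' : R -> 'M[R]_(n, k)) s t : T s -> T t ->
  (forall t, T t -> hasdelta T Z t (A t *m Z t)) ->
  (forall t, T t -> hasdelta T Z' t (A t *m Z' t)) -> Z s = Z' s -> Z t = Z' t.
Proof.
move=> Ts Tt hZ hZ' Zs.
apply: (linear_unique Tcl Tub Ard (rdcont_cst T 0) Areg Ts _ _ Zs Tt) => u Tu;
  rewrite addr0; [exact: hZ | exact: hZ'].
Qed.

Lemma hasdelta_mulr_cst k (Z : R -> 'M[R]_n) (v : 'M[R]_(n, k)) :
  (forall t, T t -> hasdelta T Z t (A t *m Z t)) ->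
  forall t, T t -> hasdelta T (fun s => Z s *m v) t (A t *m (Z t *m v)).
Proof.
move=> hZ t Tt.
have vc : cont T (fun=> v) by apply: (hasdelta_cont Tub (f := fun=> 0)) => s _; exact: hasdelta_cst.
by have := hasdeltaM Tt vc (hZ t Tt) (hasdelta_cst T v t); rewrite mulmx0 addr0 -mulmxA.
Qed.

(** A vector w killed by X(t) gives a solution X w that vanishes at [t], hence at [t0], where it
    equals w. *)
Lemma transition_unit t : T t -> X t \in unitmx.
Proof.
move=> Tt; rewrite -unitmx_tr; apply/negPn/negP => /singular_left_kernel[v v0 vX].
have Xv : X t *m v^T = 0 by rewrite -[X t]trmxK -trmx_mul vX trmx0.
have := @homogeneous_unique 1 (fun s => X s *m v^T) (fun=> 0) t t0 Tt Tt0
  (hasdelta_mulr_cst v^T XE) _ Xv.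
rewrite X0 mul1mx => h; move/eqP: v0; apply; rewrite -[v]trmxK h ?trmx0 //.
by move=> u Tu; rewrite mulmx0; exact: hasdelta_cst.
Qed.

(** If Z is the solution started at [t], then Z X(t) and X agree at [t], hence at [t0]: Z(t0) X(t) =
    1. *)
Lemma transition_mxE t : T t -> transition_mx T A t0 t = invmx (X t).
Proof.
move=> Tt; rewrite /transition_mx; case: xgetP => [Z _ [hZ Zt]|none]; last first.
  have [Z hZ Zt] := linear_exists Tcl Tub (1%:M : 'M[R]_n) Ard (rdcont_cst T 0) Areg Tt.
  case: (none Z); split=> // u Tu; apply/hasdeltaP.
  by rewrite -[X in hasdelta _ _ _ X]addr0; exact: hZ.
have hZ' u : T u -> hasdelta T Z u (A u *m Z u) by move=> Tu; apply/hasdeltaP; exact: hZ.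
have := @homogeneous_unique n (fun s => Z s *m X t) X t t0 Tt Tt0 (hasdelta_mulr_cst (X t) hZ') XE.
rewrite Zt mul1mx X0 => /(_ erefl) h.
by rewrite -[LHS](mulmxK (transition_unit Tt)) h mul1mx.
Qed.

Lemma variation_of_constants k (F g : R -> 'M[R]_(n, k)) t : T t ->
  (forall t, T t -> hasdelta T F t (invmx (X (forward_jump T t)) *m g t)) ->
  hasdelta T (fun s => X s *m F s) t (A t *m (X t *m F t) + g t).
Proof.
move=> Tt hF; have := hasdeltaM Tt (hasdelta_cont Tub hF) (XE Tt) (hF t Tt).
rewrite mulKVmx -?mulmxA //; apply: transition_unit; exact: forward_jump_mem.
Qed.

End Transition.

(** * The Gramian criterion *)

Theorem theorem2p2 (R : realType) (T : set R)
    (hT : time_scale T) (hTub : unbounded_above T)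
    (hTmu : bounded_graininess T)
    (t0 tf : R) (ht0 : T t0) (htf : T tf) (ht0f : t0 < tf)
    (n m p : nat) (hpn : (p <= n)%N) (hmn : (m <= n)%N)
    (A : R -> 'M[R]_n) (B : R -> 'M[R]_(n, m))
    (C : R -> 'M[R]_(p, n)) (D : R -> 'M[R]_(p, m))
    (hA : mx_rd_continuous T A) (hB : mx_rd_continuous T B)
    (hC : mx_rd_continuous T C) (hD : mx_rd_continuous T D)
    (hreg : regressive T A) :
  controllable T A B C D t0 tf <->
  controllability_gramian T A B t0 tf \in unitmx.
Proof.
have Tcl : closed T by case: hT.
have Ard : rdcont T A by apply/rdcontP.
have Brd : rdcont T B by apply/rdcontP.
have [X XE0 X0] := linear_exists Tcl hTub (1%:M : 'M[R]_n) Ard (rdcont_cst T 0) hreg ht0.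
have XE t : T t -> hasdelta T X t (A t *m X t).
  by move=> Tt; rewrite -[X in hasdelta _ _ _ X]addr0; exact: XE0.
have Xu := transition_unit Tcl hTub Ard hreg ht0 XE X0.
(* By [transition_mxE] this is Phi_A(t0, sigma t), the factor in the Gramian. *)
pose Y t := invmx (X (forward_jump T t)).
have Yrd : rdcont T Y.
  apply: (rdcont_forward_jump (f := fun t => invmx (X t)) Tcl hTub).
  by apply: cont_inv => //; exact: (hasdelta_cont hTub XE).
pose K t := Y t *m B t.
have Krd : rdcont T K by exact: rdcontM.
have KKrd : rdcont T (fun t => K t *m (K t)^T) by apply: rdcontM => //; exact: rdcont_tr.
have [F hF F0] := antiderivative_exists Tcl hTub (0 : 'M[R]_n) KKrd ht0.
have GE : controllability_gramian T A B t0 tf = F tf.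
  rewrite -[F tf]subr0 -F0.
  apply: (mx_delta_integralE Tcl hTub (F := F)) => //; last exact: ltW.
  move=> t Tt.
  rewrite (transition_mxE Tcl hTub Ard hreg ht0 XE X0 (forward_jump_mem Tcl hTub t)).
  by have := hF t Tt; rewrite /K trmx_mul !mulmxA.
rewrite GE; split=> [ctrl|Gu x0 xf].
  apply/negPn/negP => /singular_left_kernel[v v0 vG].
  have cv k l (Z : 'M[R]_(k, l)) : cont T (fun=> Z).
    by apply: (hasdelta_cont hTub (f := fun=> 0)) => s _; exact: hasdelta_cst.
  (* v F v^T has derivative (v K)(v K)^T and equal values at both ends. The point tf is excluded: an
     integral up to tf does not see its integrand there. *)
  have vK t : T t -> t0 <= t -> t < tf -> v *m K t = 0.
    move=> Tt t0t ttf; apply: row_mul_tr_eq0.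
    apply: (nonneg_derivative_vanishes Tcl hTub
        (f := fun t => v *m K t *m (v *m K t)^T) (F := fun t => v *m F t *m v^T)
        _ _ _ ht0 htf _ Tt t0t ttf).
    - by apply: rdcontM; [|apply: rdcont_tr]; apply: rdcontM => //; exact: rdcont_cst.
    - move=> s Ts.
      have h1 := hasdeltaM Ts (hasdelta_cont hTub hF) (hasdelta_cst T v s) (hF s Ts).
      have := hasdeltaM Ts (cv _ _ v^T) h1 (hasdelta_cst T v^T s).
      by rewrite mul0mx add0r mulmx0 addr0 [(v *m K s)^T]trmx_mul !mulmxA.
    - by move=> s Ts; exact: row_mul_tr_ge0.
    - by rewrite vG F0 mulmx0.
  (* Steering v^T to 0 makes the conserved quantity v z equal to v v^T at [t0] and to 0 at [tf],
     which forces v = 0. *)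
  have [u /rdcontP ur [x [y [[xE x0E _] xf]]]] := ctrl v^T 0.
  have [z hz z0] := antiderivative_exists Tcl hTub v^T (rdcontM Krd ur) ht0.
  have hXz t : T t -> hasdelta T (fun s => X s *m z s) t (A t *m (X t *m z t) + B t *m u t).
    move=> Tt.
    apply: (variation_of_constants Tcl hTub Ard hreg ht0 XE X0
      (g := fun t => B t *m u t) Tt) => s Ts.
    by rewrite mulmxA; exact: hz.
  have hx t : T t -> hasdelta T x t (A t *m x t + B t *m u t).
    by move=> Tt; apply/hasdeltaP; exact: xE.
  have xz : X tf *m z tf = x tf.
    apply: (linear_unique Tcl hTub Ard (rdcontM Brd ur) hreg ht0 hXz hx _ htf).
    by rewrite X0 mul1mx z0.
  have ztf : z tf = 0 by rewrite -[z tf](mulKmx (Xu tf htf)) xz xf mulmx0.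
  have hw t (Tt : T t) := hasdeltaM Tt (hasdelta_cont hTub hz) (hasdelta_cst T v t) (hz t Tt).
  have : v *m z tf = v *m z t0.
    apply: (hasdelta_zero_const Tcl hTub hw ht0 htf (ltW ht0f)) => t Tt t0t ttf.
    by rewrite mul0mx add0r mulmxA vK // mul0mx.
  rewrite ztf z0 mulmx0 => /esym/row_mul_tr_eq0 vE.
  by rewrite vE eqxx in v0.
(* Solves x0 + F(tf) c = X(tf)^-1 xf, the target for [z] at [tf]. *)
pose c := invmx (F tf) *m (invmx (X tf) *m xf - x0).
pose u t := (K t)^T *m c.
pose z t := x0 + F t *m c.
have ur : rdcont T u by apply: rdcontM; [exact: rdcont_tr | exact: rdcont_cst].
have hz t : T t -> hasdelta T z t (Y t *m (B t *m u t)).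
  move=> Tt.
  have cc : cont T (fun=> c).
    by apply: (hasdelta_cont hTub (f := fun=> 0)) => s _; exact: hasdelta_cst.
  have := hasdeltaD (hasdelta_cst T x0 t) (hasdeltaM Tt cc (hF t Tt) (hasdelta_cst T c t)).
  by rewrite add0r mulmx0 addr0 /K !mulmxA.
exists u; first exact/rdcontP.
exists (fun t => X t *m z t), (fun t => C t *m (X t *m z t) + D t *m u t).
split; last first.
  by rewrite /z /c mulKVmx // addrC subrK mulKVmx // Xu.
split=> //; last by rewrite X0 mul1mx /z F0 mul0mx addr0.
move=> t Tt; apply/hasdeltaP.
exact: (variation_of_constants Tcl hTub Ard hreg ht0 XE X0 (g := fun t => B t *m u t) Tt).
Qed.
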